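(* Let $\lambda>0$. In the decomposition of the Hilbert module $\mathbb A^{(\lambda)}(\mathbb D^3)$ over $\mathbb C[\boldsymbol z]^{\mathfrak S_3}$, $$\mathbb A^{(\lambda)}(\mathbb D^3)=\mathbb P_{(3)}\big(\mathbb A^{(\lambda)}(\mathbb D^3)\big)\oplus\mathbb P_{(2,1)}\big(\mathbb A^{(\lambda)}(\mathbb D^3)\big)\oplus\mathbb P_{(1,1,1)}\big(\mathbb A^{(\lambda)}(\mathbb D^3)\big),$$ all the sub-modules on the right-hand side are (pairwise) inequivalent.
   Context: $\mathbb D^3$ is the open unit polydisc in $\mathbb C^3$. $\mathbb A^{(\lambda)}(\mathbb D^3)$ is the Hilbert space of holomorphic functions on $\mathbb D^3$ with reproducing kernel $\prod_{j=1}^3(1-z_j\bar w_j)^{-\lambda}$. The symmetric group $\mathfrak S_3$ acts on $\mathbb C^3$ by $\sigma\cdot\boldsymbol z=(z_{\sigma^{-1}(1)},z_{\sigma^{-1}(2)},z_{\sigma^{-1}(3)})$, and $(f\circ\sigma^{-1})(\boldsymbol z)=f(\sigma^{-1}\cdot\boldsymbol z)$. For a partition $\boldsymbol p$ of $3$, $\chi_{\boldsymbol p}$ is the character of the irreducible representation of $\mathfrak S_3$ corresponding to $\boldsymbol p$ ($(3)$ is the trivial representation, $(1,1,1)$ the sign representation, $(2,1)$ the two-dimensional one), and $\mathbb P_{\boldsymbol p}f=\frac{\chi_{\boldsymbol p}(1)}{3!}\sum_{\sigma\in\mathfrak S_3}\overline{\chi_{\boldsymbol p}(\sigma)}(f\circ\sigma^{-1})$,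 an orthogonal projection whose range is a reducing submodule for the action of the ring $\mathbb C[\boldsymbol z]^{\mathfrak S_3}$ of symmetric polynomials by pointwise multiplication. Two Hilbert modules over $\mathbb C[\boldsymbol z]^{\mathfrak S_3}$ are equivalent if there is a unitary operator between them intertwining multiplication by every symmetric polynomial. *)

(* Defs.v *)
From HB Require Import structures.
From mathcomp Require Import all_boot all_order all_algebra all_fingroup.
From mathcomp Require Import mxrepresentation complex ring.
From mathcomp Require Import all_classical all_reals all_analysis.
From mathcomp Require mpoly.

Set Implicit Arguments.
Unset Strict Implicit.
Unset Printing Implicit Defensive.

Import Order.TTheory GRing.Theory Num.Theory.
Import numFieldNormedType.Exports.

Local Open Scope classical_set_scope.
Local Open Scope ring_scope.

(* The complex numbers over R, seen through the interface from which the
   analysis library derives their topology. *)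
Definition Cx (R : realType) : numClosedFieldType := R[i].

(** * Hilbert spaces of functions *)

Section HilbertSpace.
Variables (R : realType) (F : lmodType (Cx R)).
Implicit Types (V W : set F) (ip : F -> F -> Cx R) (f g h : F).

Definition subspace V : Prop :=
  V 0 /\ forall (a : Cx R) f g, V f -> V g -> V (a *: f + g).

(* Inner products are linear in the first argument.  A space is a subset V of
   the ambient F; the values of ip outside of V are irrelevant. *)
Definition inner_product V ip : Prop :=
  [/\ forall (a : Cx R) f g h, V f -> V g -> V h ->
        ip (a *: f + g) h = a * ip f h + ip g h,
      forall f g, V f -> V g -> ip g f = (ip f g)^*
    & forall f, V f -> f != 0 -> 0 < ip f f].

Definition hnorm ip f : R := Num.sqrt (complex.Re (ip f f)).

Definition complete_space V ip : Prop :=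
  forall u : nat -> F, (forall n, V (u n)) ->
    (forall e : R, 0 < e -> exists N, forall m n, (N <= m)%N -> (N <= n)%N ->
       hnorm ip (u m - u n) < e) ->
    exists2 f, V f & forall e : R, 0 < e ->
      exists N, forall n, (N <= n)%N -> hnorm ip (u n - f) < e.

Definition hilbert_space V ip : Prop :=
  [/\ subspace V, inner_product V ip & complete_space V ip].

End HilbertSpace.

(* The partitions (3), (2,1) and (1,1,1) of 3. *)
Inductive partition3 := Part3 | Part21 | Part111.

Section Polydisc.
Variable R : realType.
Local Notation C := (Cx R).

Definition in_polydisc (z : 'rV[C]_3) : bool := [forall j, `|z 0 j| < 1].

Definition polydisc : Type := {z : 'rV[C]_3 | in_polydisc z}.

(* Functions on the polydisc, a C-vector space for the pointwise operations. *)
Definition pfun : Type := polydisc -> C^o.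

(* [differentiable] is taken over the field C, hence means complex
   differentiability; as the polydisc is open, the values of the extension g
   outside of it are irrelevant. *)
Definition holomorphic (f : pfun) : Prop :=
  exists2 g : 'rV[C]_3 -> C^o, (forall z : polydisc, f z = g (val z)) &
    (forall z : polydisc, differentiable g (val z)).

Definition is_reproducing_kernel (V : set pfun) (ip : pfun -> pfun -> C)
    (K : polydisc -> polydisc -> C) : Prop :=
  forall w : polydisc, V (K ^~ w) /\ forall f, V f -> ip f (K ^~ w) = f w.

(* The principal branch of u ^ a, for u in the half-plane Re u > 0, where the
   principal argument of u is atan (Im u / Re u). *)
Definition cpow (u : R[i]) (a : R) : C :=
  let r := Normc.normc u `^ a in
  let t := a * atan (complex.Im u / complex.Re u) in
  Complex (r * cos t) (r * sin t).

(* Re (1 - z_j w_j^* ) > 0 on the polydisc. *)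
Definition bergman_kernel (lambda : R) (z w : polydisc) : C :=
  \prod_(j < 3) cpow (1 - val z 0 j * (val w 0 j)^*) (- lambda).

(* (A, ip) is the Hilbert space of holomorphic functions on the polydisc with
   reproducing kernel [bergman_kernel lambda]; a Hilbert space of functions is
   determined by its reproducing kernel. *)
Definition weighted_bergman_space (lambda : R) (A : set pfun)
    (ip : pfun -> pfun -> C) : Prop :=
  [/\ hilbert_space A ip,
      forall f, A f -> holomorphic f
    & is_reproducing_kernel A ip (bergman_kernel lambda)].

(** * Hilbert modules over the ring of symmetric polynomials *)

Definition pmul (q : mpoly.mpoly 3 C) (f : pfun) : pfun :=
  fun z => mpoly.meval (fun j => val z 0 j) q * f z.

Definition hilbert_module (V : set pfun) (ip : pfun -> pfun -> C) : Prop :=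
  hilbert_space V ip /\
  forall q : mpoly.mpoly 3 C, q \is @mpoly.symmetric 3 C ->
    (forall f, V f -> V (pmul q f)) /\
    exists c : R, forall f, V f -> hnorm ip (pmul q f) <= c * hnorm ip f.

(* Equivalence of two submodules V and W of a Hilbert module with inner product
   ip; only the restriction of U to V matters. *)
Definition equivalent (ip : pfun -> pfun -> C) (V W : set pfun) : Prop :=
  exists U : pfun -> pfun,
    [/\ U @` V = W,
        forall (a : C) f g, V f -> V g -> U (a *: f + g) = a *: U f + U g,
        forall f g, V f -> V g -> ip (U f) (U g) = ip f g
      & forall q : mpoly.mpoly 3 C, q \is @mpoly.symmetric 3 C ->
          forall f, V f -> U (pmul q f) = pmul q (U f)].

(** * The action of the symmetric group *)

Lemma in_polydisc_perm (s : 'S_3) (z : 'rV[C]_3) :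
  in_polydisc z -> in_polydisc (\row_j z 0 (s^-1%g j)).
Proof. by move=> /forallP zD; apply/forallP => j; rewrite mxE. Qed.

Definition pact (s : 'S_3) (z : polydisc) : polydisc :=
  exist _ (\row_j val z 0 (s^-1%g j)) (in_polydisc_perm s (valP z)).

Definition irrep_dim (p : partition3) : nat :=
  match p with Part3 => 1 | Part21 => 2 | Part111 => 1 end.

(* The two-dimensional representation is the standard one: permutations of the
   coordinates, acting on the row vectors of C^3 with zero sum.  The matrices
   are written in the basis e_0 - e_2, e_1 - e_2, whose vectors are the rows of
   [std_basis]; the coordinates of a zero-sum vector v are v *m pid_mx 2. *)
Definition std_basis : 'M[C]_(2, 3) :=
  \matrix_(i, j) ((i == j :> nat)%:R - (j == 2%N :> nat)%:R).

Definition irrep_mx (p : partition3) (s : 'S_3) : 'M[C]_(irrep_dim p) :=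
  match p return 'M[C]_(irrep_dim p) with
  | Part3 => 1%:M
  | Part21 => std_basis *m perm_mx s *m (pid_mx 2 : 'M[C]_(3, 2))
  | Part111 => ((-1) ^+ s)%:M
  end.

Lemma irrep_mx_repr p : mx_repr [set: 'S_3]%SET (irrep_mx p).
Proof.
have idB : (pid_mx 2 : 'M[C]_(3, 2)) *m std_basis
    = 1%:M - \matrix_(i, j) (j == 2%N :> nat)%:R.
  apply/matrixP => i j; rewrite !mxE !big_ord_recl big_ord0 !mxE /=.
  case: i => [[|[|[|]]]] //= ?; case: j => [[|[|[|]]]] //= ?; rewrite -?val_eqE /=; ring.
have Bid : std_basis *m (pid_mx 2 : 'M[C]_(3, 2)) = 1%:M.
  apply/matrixP => i j; rewrite !mxE !big_ord_recl big_ord0 !mxE /=.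
  case: i => [[|[|]]] //= ?; case: j => [[|[|]]] //= ?; rewrite -?val_eqE /=; ring.
have B0 : std_basis *m const_mx 1 = 0 :> 'M[C]_(2, 3).
  apply/matrixP => i j; rewrite !mxE !big_ord_recl big_ord0 !mxE /=.
  case: i => [[|[|]]] //= ?; rewrite -?val_eqE /=; ring.
split; case: p => //=.
- by rewrite perm_mx1 mulmx1.
- by rewrite odd_perm1.
- by move=> *; rewrite mulmx1.
- move=> s t _ _; rewrite perm_mxM !mulmxA.
  rewrite -(mulmxA (_ *m perm_mx s) (pid_mx 2)) idB mulmxBr mulmx1.
  rewrite !mulmxBl -[LHS]subr0; congr (_ - _).
  suff -> : std_basis *m perm_mx s *m (\matrix_(i < 3, j < 3) (j == 2%N :> nat)%:R) = 0.
    by rewrite !mul0mx.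
  have -> : (\matrix_(i < 3, j < 3) (j == 2%N :> nat)%:R)
     = const_mx 1 *m \matrix_(i < 3, j < 3) ((i == 0) && (j == 2%N :> nat))%:R :> 'M[C]_3.
    apply/matrixP => i j; rewrite !mxE !big_ord_recl big_ord0 !mxE /=; ring.
  rewrite !mulmxA -(mulmxA _ (perm_mx s)).
  have -> : perm_mx s *m const_mx 1 = const_mx 1 :> 'M[C]_3.
    by rewrite -row_permE; apply/matrixP => i j; rewrite !mxE.
  by rewrite B0 mul0mx.
- by move=> s t _ _; rewrite odd_permM signr_addb scalar_mxM.
Qed.

Definition irrep (p : partition3) : mx_representation C [set: 'S_3]%SET (irrep_dim p) :=
  MxRepresentation (irrep_mx_repr p).

Lemma std_mxE (s : 'S_3) (v : 'rV[C]_2) (b : 'I_2) :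
  (v *m irrep_mx Part21 s) 0 b =
  v 0 0 * ((s 0 == b :> nat)%:R - (s ord_max == b :> nat)%:R)
  + v 0 1 * ((s 1 == b :> nat)%:R - (s ord_max == b :> nat)%:R).
Proof.
have E (k : 'I_3) : (perm_mx s *m (pid_mx 2 : 'M[C]_(3, 2))) k b = (s k == b :> nat)%:R.
  rewrite -row_permE !mxE; congr (nat_of_bool _)%:R.
  by apply: andb_idr => /eqP->.
rewrite /irrep_mx -!mulmxA mxE.
have S3 (F : 'I_3 -> C) : \sum_i F i = F 0 + F 1 + F ord_max.
  rewrite !big_ord_recl big_ord0 addr0 addrA; congr (F _ + F _ + F _); exact/val_inj.
have S2 (F : 'I_2 -> C) : \sum_i F i = F 0 + F 1.
  rewrite !big_ord_recl big_ord0 addr0; congr (F _ + F _); exact/val_inj.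
rewrite S2; congr (_ * _ + _ * _); rewrite mxE S3 !E !mxE /=; ring.
Qed.

Lemma std_row (s : 'S_3) (v : 'rV[C]_2) :
  v *m irrep_mx Part21 s = \row_(b < 2)
  (v 0 0 * ((s 0 == b :> nat)%:R - (s ord_max == b :> nat)%:R)
  + v 0 1 * ((s 1 == b :> nat)%:R - (s ord_max == b :> nat)%:R)).
Proof. by apply/rowP => b; rewrite std_mxE mxE. Qed.

Lemma irrep_mx_irr p : mx_irreducible (irrep p).
Proof.
set rG := irrep p.
suff H : forall v : 'rV_(irrep_dim p), v != 0 -> forall U : 'M[C]_(irrep_dim p), (v <= U)%MS -> mxmodule rG U -> (1%:M <= U)%MS.
  apply/mx_irrP; split; first by case: (p).
  move=> U Um Un0; rewrite -sub1mx.
  have /rowV0Pn[v vU vn0] := Un0.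
  exact: (H v).
case: p @rG => rG v vn0 U vU Um.
- apply: submx_trans vU. rewrite sub1mx /row_full rank_rV vn0 //.
- have UM (w : 'rV[C]_2) (s : 'S_3) :
      (w <= U)%MS -> (w *m irrep_mx Part21 s <= U)%MS.
    move=> wU; apply: submx_trans (submxMr _ wU) _.
    by have /mxmoduleP/(_ s (finset.in_setT s)) := Um.
  have o2 (j : 'I_2) : j = 0 \/ j = 1.
    by case: j => [[|[|]]] // jlt; [left|right]; apply/val_inj.
  have T01 (w : 'rV[C]_2) : w *m irrep_mx Part21 (tperm 0 1) =
      w 0 1 *: delta_mx 0 0 + w 0 0 *: delta_mx 0 1.
    apply/rowP => j; rewrite std_mxE !permE !mxE /=.
    case: j => [[|[|]]] //= jlt; rewrite -?val_eqE /=; ring.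
  have T02 (w : 'rV[C]_2) : w - w *m irrep_mx Part21 (tperm 0 ord_max) =
      (w 0 0 *+ 2 + w 0 1) *: delta_mx 0 0.
    rewrite std_row; apply/rowP => j; rewrite !mxE !permE /=.
    by case: (o2 j) => -> /=; rewrite ?eqxx /=; ring.
  have T12 (w : 'rV[C]_2) : w - w *m irrep_mx Part21 (tperm 1 ord_max) =
      (w 0 1 *+ 2 + w 0 0) *: delta_mx 0 1.
    rewrite std_row; apply/rowP => j; rewrite !mxE !permE /=.
    by case: (o2 j) => -> /=; rewrite ?eqxx /=; ring.
  have D (w : 'rV[C]_2) (s : 'S_3) : (w <= U)%MS -> (w - w *m irrep_mx Part21 s <= U)%MS.
    by move=> wU; rewrite addmx_sub ?eqmx_opp ?UM.
  have d01 (i : 'I_2) : ((delta_mx 0 i : 'rV[C]_2) <= U)%MS -> (1%:M <= U)%MS.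
    move=> iU; have jU := UM _ (tperm 0 1) iU; rewrite T01 !mxE /= in jU.
    apply/row_subP => k; rewrite row1.
    by case: (o2 i) iU jU => ->; rewrite /= ?scale1r ?scale0r ?addr0 ?add0r;
      case: (o2 k) => ->.
  have sc (x : C) (i : 'I_2) : x != 0 -> (x *: (delta_mx 0 i : 'rV[C]_2) <= U)%MS ->
      ((delta_mx 0 i : 'rV[C]_2) <= U)%MS.
    by move=> x0 /(scalemx_sub x^-1); rewrite scalerA mulVf // scale1r.
  have := D _ (tperm 0 ord_max) vU; rewrite T02.
  have := D _ (tperm 1 ord_max) vU; rewrite T12.
  have [a0 |/sc h] := eqVneq (v 0 1 *+ 2 + v 0 0) 0; last by move=> /h /d01.
  have [b0 _ _|/sc h _] := eqVneq (v 0 0 *+ 2 + v 0 1) 0; last by move=> /h /d01.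
  have e1 : v 0 1 = 0.
    have : 3%:R * v 0 1 = 0.
      transitivity ((v 0 1 *+ 2 + v 0 0) *+ 2 - (v 0 0 *+ 2 + v 0 1)); first by ring.
      by rewrite a0 b0 mul0rn subr0.
    by move/eqP; rewrite mulf_eq0 pnatr_eq0 /= => /eqP.
  case/eqP: vn0; apply/rowP => j; rewrite mxE.
  move: b0 a0; rewrite e1 mul0rn addr0 add0r => _ e0.
  by case: (o2 j) => ->.
- apply: submx_trans vU. rewrite sub1mx /row_full rank_rV vn0 //.
Qed.

Definition character (p : partition3) (s : 'S_3) : C := \tr (irrep p s).

Definition isotypic_proj (p : partition3) (f : pfun) : pfun :=
  (character p 1%g / (3`!)%:R) *:
    \sum_(s : 'S_3) (character p s)^* *: ((fun z => f (pact s^-1%g z)) : pfun).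

(* A is the orthogonal direct sum of the subspaces V Part3, V Part21, V Part111. *)
Definition orthogonal_sum (ip : pfun -> pfun -> C) (A : set pfun)
    (V : partition3 -> set pfun) : Prop :=
  (forall p q f g, p <> q -> V p f -> V q g -> ip f g = 0) /\
  A = [set f | exists f1 f2 f3, [/\ V Part3 f1, V Part21 f2, V Part111 f3
                                  & f = f1 + f2 + f3]].

End Polydisc.

(* Main.v *)
(** The kernel is expanded with the binomial series; all coefficients
   a_n = (lambda)_n / n! are positive.  A function f belongs to a reproducing
   kernel space, with norm^2 at most c, as soon as c K - f f^* is a positive
   kernel.  This single criterion shows that the coordinates are bounded
   multipliers, that permutations and rotations of the coordinates act
   unitarily, and that the monomials belong to the space; they are orthogonal
   and total, with norm^2 equal to the product of the 1 / a_(alpha_j).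

   The projections are self-adjoint idempotents since
   2 chi_(2,1) + 1 + sgn = 6 [s = 1].  For the inequivalence, call F cyclic in a
   submodule if the products q F, q symmetric, span a dense subspace.  The
   constant 1 is cyclic for (3) and the Vandermonde determinant Delta is cyclic
   for (1,1,1), whereas (2,1) has no cyclic vector F: on an orbit of S_3, all
   elements of the submodule would be proportional to F, but z_0 - z_1 and
   z_1 - z_2 are not proportional.  Finally an equivalence U from (3) to (1,1,1)
   must send 1 to a multiple of Delta, because U 1 is orthogonal to q Delta
   whenever q(0) = 0; comparing the norms of z_0 + z_1 + z_2 and
   (z_0 + z_1 + z_2) Delta gives 3 / lambda = 3 / (lambda + 2). *)

From HB Require Import structures.
From mathcomp Require Import all_boot all_order all_algebra all_fingroup.
From mathcomp Require Import mxrepresentation complex ring lra zify.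
From mathcomp Require Import all_classical all_reals all_analysis.
From mathcomp Require Import -(notations) mpoly.
Require Import Defs.

Set Implicit Arguments.
Unset Strict Implicit.
Unset Printing Implicit Defensive.

Import Order.TTheory GRing.Theory Num.Theory.
Import numFieldNormedType.Exports.

Local Open Scope classical_set_scope.
Local Open Scope ring_scope.

(** * Complex numbers and inner products *)

(** The space is given only by its kernel, with neither an integral nor a coefficient formula for
    the norm, so even the membership of a monomial has to be extracted from a positivity statement.
    Positivity gives only an upper bound 1 / a_alpha for the squared norm of z^alpha; this bound
    already makes the expansion of K(., w) converge in norm, and the expansion then forces equality
    and totality.

    Cyclic vectors single out (2,1) because symmetric polynomials are constant on orbits: over a
    generic orbit a module with a cyclic vector is one-dimensional, while functions of type (2,1)
    have dimension 2^2 = 4 there. Both (3) and (1,1,1) have rank one, so this invariant cannot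
    separate them and metric data are needed. If U G = Delta, then <U 1, q Delta> = <1, q G> is the
    conjugate of q(0) G(0), because 1 is the kernel function at the origin. The norms compared at
    the end are governed by consecutive coefficients: a_0 / a_1 = 1 / lambda, taken three times, on
    the side of 1, and a_2 / a_3 = 3 / (lambda + 2) on the side of Delta. *)

Section ComplexParts.
Variable R : realType.
Local Notation C := (Cx R).
Implicit Types (x y : C) (r : R).

Definition re x : R := complex.Re x.
Definition im x : R := complex.Im x.
Definition rC r : C := Complex r 0.
Definition sqn x : R := re x ^+ 2 + im x ^+ 2.

Lemma ceqP x y : re x = re y -> im x = im y -> x = y.
Proof. by case: x y => [a b] [c d] /= -> ->. Qed.

Lemma re0 : re 0 = 0. Proof. by []. Qed.
Lemma im0 : im 0 = 0. Proof. by []. Qed.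
Lemma re1 : re 1 = 1. Proof. by []. Qed.
Lemma im1 : im 1 = 0. Proof. by []. Qed.
Lemma reD x y : re (x + y) = re x + re y. Proof. by case: x y => [? ?] [? ?]. Qed.
Lemma imD x y : im (x + y) = im x + im y. Proof. by case: x y => [? ?] [? ?]. Qed.
Lemma reN x : re (- x) = - re x. Proof. by case: x. Qed.
Lemma imN x : im (- x) = - im x. Proof. by case: x. Qed.
Lemma reM x y : re (x * y) = re x * re y - im x * im y.
Proof. by case: x y => [? ?] [? ?]. Qed.
Lemma imM x y : im (x * y) = re x * im y + im x * re y.
Proof. by case: x y => [? ?] [? ?]. Qed.
Lemma conjE x : x^* = conjc x.
Proof. by []. Qed.
Lemma re_conj x : re x^* = re x. Proof. by rewrite conjE; case: x. Qed.
Lemma im_conj x : im x^* = - im x. Proof. by rewrite conjE; case: x. Qed.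
Lemma re_rC r : re (rC r) = r. Proof. by []. Qed.
Lemma im_rC r : im (rC r) = 0. Proof. by []. Qed.

(** Rewriting with this rule turns a complex identity into real ones, within reach of [ring], [lra]
    and [nra]. *)
Definition cE := (re0, im0, re1, im1, reD, imD, reN, imN, reM, imM, re_conj,
  im_conj, re_rC, im_rC).

Lemma re_sum (I : Type) (s : seq I) (P : pred I) (F : I -> C) :
  re (\sum_(i <- s | P i) F i) = \sum_(i <- s | P i) re (F i).
Proof. by apply: (big_morph re reD re0). Qed.
Lemma rC0 : rC 0 = 0. Proof. by []. Qed.
Lemma rC1 : rC 1 = 1. Proof. by []. Qed.
Lemma rCD r r' : rC (r + r') = rC r + rC r'. Proof. by apply: ceqP; rewrite !cE ?addr0. Qed.
Lemma rCN r : rC (- r) = - rC r. Proof. by apply: ceqP; rewrite !cE ?oppr0. Qed.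
Lemma rCM r r' : rC (r * r') = rC r * rC r'.
Proof. by apply: ceqP; rewrite !cE ?mulr0 ?mul0r ?subr0 ?addr0. Qed.
Lemma rC_prod (I : Type) (s : seq I) (P : pred I) (F : I -> R) :
  rC (\prod_(i <- s | P i) F i) = \prod_(i <- s | P i) rC (F i).
Proof. by apply: (big_morph rC rCM rC1). Qed.
Lemma rC_sum (I : Type) (s : seq I) (P : pred I) (F : I -> R) :
  rC (\sum_(i <- s | P i) F i) = \sum_(i <- s | P i) rC (F i).
Proof. by apply: (big_morph rC rCD rC0). Qed.
Lemma rC_inj : injective rC. Proof. by move=> r r' []. Qed.
Lemma rC_conj r : (rC r)^* = rC r.
Proof. by apply: ceqP; rewrite !cE ?oppr0. Qed.
Lemma rC_nat n : rC n%:R = n%:R.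
Proof. by elim: n => // n IH; rewrite -addn1 !natrD rCD IH. Qed.
Lemma rCV r : rC r^-1 = (rC r)^-1.
Proof.
have [->|r0] := eqVneq r 0; first by rewrite rC0 !invr0.
have r0' : rC r != 0 by apply: contra_neq r0 => /rC_inj.
by apply: (mulfI r0'); rewrite -rCM !mulfV.
Qed.

Lemma sqn_ge0 x : 0 <= sqn x. Proof. by rewrite addr_ge0 ?sqr_ge0. Qed.
Lemma sqn0 : sqn 0 = 0. Proof. by rewrite /sqn !cE; ring. Qed.
Lemma sqn_eq0 x : sqn x <= 0 -> x = 0.
Proof. by move=> h; apply: ceqP; rewrite !cE; move: h; rewrite /sqn; nra. Qed.
Lemma sqnM x y : sqn (x * y) = sqn x * sqn y.
Proof. by rewrite /sqn !cE; ring. Qed.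
Lemma sqn_conj x : sqn x^* = sqn x. Proof. by rewrite /sqn !cE; ring. Qed.
Lemma mul_conj x : x * x^* = rC (sqn x).
Proof. by apply: ceqP; rewrite /sqn !cE; ring. Qed.
Lemma sqnX x n : sqn (x ^+ n) = sqn x ^+ n.
Proof. by elim: n => [|n IH]; rewrite ?expr0 ?exprS ?sqnM ?IH // /sqn !cE; ring. Qed.

Lemma sqn_rC r : sqn (rC r) = r ^+ 2.
Proof. by rewrite /sqn !cE; ring. Qed.
Lemma sqnV x : sqn x^-1 = (sqn x)^-1.
Proof.
have [->|x0] := eqVneq x 0; first by rewrite invr0 sqn0 invr0.
have s0 : sqn x != 0 by apply: contra_neq x0 => s0; apply: sqn_eq0; rewrite s0.
apply: (mulfI s0); rewrite -sqnM !mulfV // /sqn !cE; ring.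
Qed.

Lemma norm_lt1 x : (`|x| < 1) = (sqn x < 1).
Proof.
rewrite normc_def ltcE /= eqxx /=.
by rewrite -[X in _ < X]sqrtr1 ltr_sqrt.
Qed.

End ComplexParts.

(** * Inner products and squared norms *)

Section InnerProduct.
Variables (R : realType) (F : lmodType (Cx R)) (V : set F) (ip : F -> F -> Cx R).
Hypotheses (subV : subspace V) (ipV : inner_product V ip).
Local Notation C := (Cx R).
Implicit Types (f g h : F) (a b : C).

(** Squared norms replace [hnorm] in all estimates, which keeps them polynomial; [completeP] and
    [hnorm_le] translate back. *)
Definition nsq (f : F) : R := re (ip f f).

Lemma sub0V : V 0. Proof. by case: subV. Qed.
Lemma subPV a f g : V f -> V g -> V (a *: f + g).
Proof. by case: subV => _; apply. Qed.
Lemma subDV f g : V f -> V g -> V (f + g).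
Proof. by move=> Vf Vg; rewrite -[f]scale1r; apply: subPV. Qed.
Lemma subZV a f : V f -> V (a *: f).
Proof. by move=> Vf; rewrite -[_ *: _]addr0; apply: subPV => //; exact: sub0V. Qed.
Lemma subNV f : V f -> V (- f).
Proof. by move=> Vf; rewrite -scaleN1r; apply: subZV. Qed.
Lemma subBV f g : V f -> V g -> V (f - g).
Proof. by move=> Vf Vg; apply: subDV => //; apply: subNV. Qed.
Lemma sub_sumV (I : Type) (s : seq I) (P : pred I) (G : I -> F) :
  (forall i, P i -> V (G i)) -> V (\sum_(i <- s | P i) G i).
Proof.
move=> h; elim/big_rec: _ => [|i x Pi Vx]; first exact: sub0V.
by apply: subDV => //; apply: h.
Qed.

Lemma ipPl a f g h : V f -> V g -> V h -> ip (a *: f + g) h = a * ip f h + ip g h.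
Proof. by case: ipV => H _ _; apply: H. Qed.
Lemma ip_conj f g : V f -> V g -> ip g f = (ip f g)^*.
Proof. by case: ipV => _ H _; apply: H. Qed.
Lemma ipDl f g h : V f -> V g -> V h -> ip (f + g) h = ip f h + ip g h.
Proof. by move=> *; rewrite -[f in LHS]scale1r ipPl // mul1r. Qed.
Lemma ip0l h : V h -> ip 0 h = 0.
Proof.
move=> Vh; have := ipDl sub0V sub0V Vh; rewrite addr0 => e.
by apply: (addrI (ip 0 h)); rewrite -e addr0.
Qed.
Lemma ipZl a f h : V f -> V h -> ip (a *: f) h = a * ip f h.
Proof. by move=> Vf Vh; rewrite -[a *: f]addr0 ipPl ?ip0l ?addr0 //; exact: sub0V. Qed.
Lemma ipNl f h : V f -> V h -> ip (- f) h = - ip f h.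
Proof. by move=> *; rewrite -scaleN1r ipZl // mulN1r. Qed.
Lemma ipBl f g h : V f -> V g -> V h -> ip (f - g) h = ip f h - ip g h.
Proof. by move=> *; rewrite ipDl ?ipNl //; apply: subNV. Qed.
Lemma ipDr f g h : V f -> V g -> V h -> ip h (f + g) = ip h f + ip h g.
Proof.
move=> Vf Vg Vh; rewrite ip_conj //; last exact: subDV.
by rewrite ipDl // rmorphD /= -!ip_conj.
Qed.
Lemma ipZr a f h : V f -> V h -> ip h (a *: f) = a^* * ip h f.
Proof.
move=> Vf Vh; rewrite ip_conj //; last exact: subZV.
by rewrite ipZl // rmorphM /= -ip_conj.
Qed.
Lemma ip0r h : V h -> ip h 0 = 0.
Proof. by move=> Vh; rewrite ip_conj ?ip0l ?rmorph0 //; exact: sub0V. Qed.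
Lemma ipNr f h : V f -> V h -> ip h (- f) = - ip h f.
Proof. by move=> *; rewrite -scaleN1r ipZr // rmorphN rmorph1 mulN1r. Qed.
Lemma ipBr f g h : V f -> V g -> V h -> ip h (f - g) = ip h f - ip h g.
Proof. by move=> *; rewrite ipDr ?ipNr //; apply: subNV. Qed.
Lemma ip_suml (I : Type) (s : seq I) (P : pred I) (G : I -> F) h :
  (forall i, P i -> V (G i)) -> V h ->
  ip (\sum_(i <- s | P i) G i) h = \sum_(i <- s | P i) ip (G i) h.
Proof.
move=> VG Vh; elim: s => [|i s IH]; first by rewrite !big_nil ip0l.
rewrite !big_cons; case: ifP => // Pi.
by rewrite ipDl ?IH //; [exact: VG | exact: sub_sumV].
Qed.
Lemma ip_sumr (I : Type) (s : seq I) (P : pred I) (G : I -> F) h :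
  (forall i, P i -> V (G i)) -> V h ->
  ip h (\sum_(i <- s | P i) G i) = \sum_(i <- s | P i) ip h (G i).
Proof.
move=> VG Vh; rewrite ip_conj //; last exact: sub_sumV.
rewrite ip_suml // rmorph_sum /=; apply: eq_bigr => i Pi.
by rewrite -ip_conj //; exact: VG.
Qed.

Lemma nsq0 : nsq 0 = 0.
Proof. by rewrite /nsq ip0l //; exact: sub0V. Qed.
Lemma im_ipff f : V f -> im (ip f f) = 0.
Proof.
move=> Vf; have : im (ip f f) = im (ip f f)^* by rewrite -ip_conj.
by rewrite im_conj; lra.
Qed.
Lemma ipff f : V f -> ip f f = rC (nsq f).
Proof. by move=> Vf; apply: ceqP => //=; rewrite im_ipff. Qed.
Lemma nsq_gt0 f : V f -> f != 0 -> 0 < nsq f.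
Proof.
case: ipV => _ _ H Vf f0; have := H _ Vf f0.
by rewrite ltcE => /andP[_].
Qed.
Lemma nsq_ge0 f : V f -> 0 <= nsq f.
Proof.
by move=> Vf; have [->|/(nsq_gt0 Vf)/ltW//] := eqVneq f 0; rewrite nsq0.
Qed.
Lemma nsq_le0 f : V f -> nsq f <= 0 -> f = 0.
Proof. by move=> Vf; have [//|/(nsq_gt0 Vf)] := eqVneq f 0; case: ltgtP. Qed.
Lemma nsqP a f g : V f -> V g ->
  nsq (a *: f + g) = sqn a * nsq f + 2 * re (a * ip f g) + nsq g.
Proof.
move=> Vf Vg; have Vaf := subZV a Vf; have V1 := subPV a Vf Vg.
rewrite /nsq ipPl // !ipDr // !ipZr // (ipff Vf) (ip_conj Vf Vg) /sqn !cE.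
by rewrite /nsq; ring.
Qed.
Lemma nsqD f g : V f -> V g -> nsq (f + g) = nsq f + 2 * re (ip f g) + nsq g.
Proof. by move=> Vf Vg; rewrite -[f in LHS]scale1r nsqP // mul1r /sqn !cE; ring. Qed.
Lemma nsqB f g : V f -> V g -> nsq (f - g) = nsq f - 2 * re (ip f g) + nsq g.
Proof.
move=> Vf Vg; rewrite addrC -scaleN1r nsqP // (ip_conj Vf Vg) mulN1r /sqn !cE.
by ring.
Qed.
Lemma nsqZ a f : V f -> nsq (a *: f) = sqn a * nsq f.
Proof.
move=> Vf; rewrite /nsq ipZl ?ipZr ?(ipff Vf) //; last exact: subZV.
by rewrite /sqn !cE; ring.
Qed.
Lemma nsqN f : V f -> nsq (- f) = nsq f.
Proof. by move=> Vf; rewrite -scaleN1r nsqZ // /sqn !cE; ring. Qed.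

Lemma cauchy_schwarz f g : V f -> V g -> sqn (ip f g) <= nsq f * nsq g.
Proof.
move=> Vf Vg; have [g0|g0] := lerP (nsq g) 0.
  by rewrite (nsq_le0 Vg g0) ip0r // nsq0 sqn0 mulr0.
(* The vector is f minus its orthogonal projection on g. *)
have := nsq_ge0 (subPV (rC (- (nsq g)^-1)) (subZV (ip f g) Vg) Vf).
rewrite nsqP //; last exact: subZV.
rewrite nsqZ // ipZl // (ip_conj Vf Vg) mul_conj -rCM /= {1}/sqn !cE.
rewrite expr0n addr0 sqrrN exprVn.
have -> : nsq g ^- 2 * (sqn (ip f g) * nsq g) = sqn (ip f g) / nsq g.
  by field; rewrite gt_eqF.
move=> h; rewrite -ler_pdivrMr //.
have e : - (nsq g)^-1 * sqn (ip f g) = - (sqn (ip f g) / nsq g) by ring.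
by move: h; rewrite e; lra.
Qed.

Lemma nsqD_le f g : V f -> V g -> nsq (f + g) <= 2 * (nsq f + nsq g).
Proof.
move=> Vf Vg; have := nsq_ge0 (subBV Vf Vg); rewrite nsqB // nsqD //; lra.
Qed.

(** Four scalars suffice: 0 compares the norms of g and g', the pair 1 and -1 isolates the real
    part, and i the imaginary part. *)
Lemma polarization f g f' g' : V f -> V g -> V f' -> V g' ->
  (forall a, nsq (a *: f' + g') = nsq (a *: f + g)) -> ip f' g' = ip f g.
Proof.
move=> Vf Vg Vf' Vg' H.
have e0 := H 0; rewrite !nsqP // !mul0r sqn0 !mul0r !add0r !cE in e0.
have := H 1; have := H (-1); have := H (Complex 0 1); rewrite !nsqP // /sqn !cE /= => e1 e2 e3.
apply: ceqP; first by lra.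
have e4 : 0 ^+ 2 = 0 :> R by ring.
rewrite /re /im /= -/(re _) -/(im _) in e1 e2 e3 *.
lra.
Qed.

Lemma hnorm_lt f e : 0 < e -> hnorm ip f < e <-> nsq f < e ^+ 2.
Proof.
move=> e0; have e1 := exprn_gt0 2 e0.
rewrite /hnorm -/(re _) -/(nsq f).
have -> : e = Num.sqrt (e ^+ 2) by rewrite sqrtr_sqr gtr0_norm.
by rewrite ltr_sqrt // sqr_sqrtr // ltW.
Qed.

Lemma hnorm_le (G : F -> F) c f : 0 <= c ->
  nsq (G f) <= c * nsq f -> hnorm ip (G f) <= Num.sqrt c * hnorm ip f.
Proof.
by move=> c0 h; rewrite /hnorm -sqrtrM // ler_wsqrtr.
Qed.

Lemma completeP : complete_space V ip <->
  forall u : nat -> F, (forall n, V (u n)) ->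
    (forall e : R, 0 < e -> exists N, forall m n, (N <= m)%N -> (N <= n)%N ->
       nsq (u m - u n) < e) ->
    exists2 f, V f & forall e : R, 0 < e ->
      exists N, forall n, (N <= n)%N -> nsq (u n - f) < e.
Proof.
split=> H u Vu cu; have [e e0|f Vf fu] := H u Vu.
- have [N NP] := cu _ (exprn_gt0 2 e0).
  by exists N => m n mN nN; apply/hnorm_lt => //; exact: NP.
- exists f => // e e0; have se0 : 0 < Num.sqrt e by rewrite sqrtr_gt0.
  have [N NP] := fu _ se0; exists N => n /NP /hnorm_lt.
  by rewrite sqr_sqrtr ?ltW //; apply.
- have se0 : 0 < Num.sqrt e by rewrite sqrtr_gt0.
  have [N NP] := cu _ se0; exists N => m n mN nN; have /hnorm_lt := NP m n mN nN.
  by rewrite sqr_sqrtr ?ltW //; apply.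
- exists f => // e e0; have [N NP] := fu _ (exprn_gt0 2 e0).
  by exists N => n nN; apply/hnorm_lt => //; exact: NP.
Qed.

End InnerProduct.

Lemma natSinv_lt (R : realType) (e : R) : 0 < e ->
  exists N, forall n, (N <= n)%N -> n.+1%:R^-1 < e.
Proof.
move=> e0; exists (Num.bound e^-1) => n Nn.
rewrite invf_plt ?posrE ?ltr0Sn //; apply: lt_le_trans (archi_boundP _) _.
  by rewrite invr_ge0 ltW.
by rewrite ler_nat; apply: leq_trans Nn (leqnSn n).
Qed.

(** * Positive kernels and reproducing kernel spaces *)

Section Kernels.
Variable R : realType.
Local Notation C := (Cx R).
Local Notation D := (polydisc R).
Implicit Types (k : D -> D -> C) (f g : pfun R) (s t : seq (C * D)).

(** The order of the arguments makes [qform K s] the squared norm of the sum of the x.1 K(., x.2).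
    Points may repeat in [s], so lists can be concatenated freely. *)
Definition qform k s : C :=
  \sum_(x <- s) \sum_(y <- s) x.1 * y.1^* * k y.2 x.2.

(* Only the real part is required to be nonnegative: this survives limits
   without any discussion of the order of the complex numbers. *)
Definition psd k := forall s, 0 <= re (qform k s).

Lemma qform_rank1 f g s : qform (fun z w => f z * (g w)^*) s =
  (\sum_(x <- s) x.1 * (g x.2)^*) * (\sum_(x <- s) x.1 * (f x.2)^*)^*.
Proof.
rewrite /qform big_distrl /=; apply: eq_bigr => x _.
rewrite rmorph_sum big_distrr /=; apply: eq_bigr => y _.
by rewrite rmorphM /= conjCK; ring.
Qed.

Lemma qformD k k' s : qform (fun z w => k z w + k' z w) s = qform k s + qform k' s.
Proof.
rewrite /qform -big_split; apply: eq_bigr => x _.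
by rewrite -big_split; apply: eq_bigr => y _; rewrite mulrDr.
Qed.

Lemma qformZ a k s : qform (fun z w => a * k z w) s = a * qform k s.
Proof.
rewrite /qform big_distrr; apply: eq_bigr => x _ /=.
by rewrite big_distrr; apply: eq_bigr => y _ /=; ring.
Qed.

(** * Membership in a reproducing kernel space by positivity *)

Section RKHS.
Variables (A : set (pfun R)) (ip : pfun R -> pfun R -> C) (K : D -> D -> C).
Hypotheses (hilA : hilbert_space A ip) (kerK : is_reproducing_kernel A ip K).

Let subA : subspace A. Proof. by case: hilA. Qed.
Let ipA : inner_product A ip. Proof. by case: hilA. Qed.

Definition kcomb s : pfun R := \sum_(x <- s) x.1 *: (K ^~ x.2 : pfun R).

Lemma kerA w : A (K ^~ w). Proof. by case: (kerK w). Qed.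
Lemma reproducing w f : A f -> ip f (K ^~ w) = f w.
Proof. by move=> Af; case: (kerK w) => _; apply. Qed.
Lemma reproducing_l w f : A f -> ip (K ^~ w) f = (f w)^*.
Proof. by move=> Af; rewrite (ip_conj ipA Af) ?reproducing //; exact: kerA. Qed.

Lemma kcombA s : A (kcomb s).
Proof. by apply: (sub_sumV subA) => x _; apply: (subZV subA); exact: kerA. Qed.

Lemma ip_kcombl s f : A f -> ip (kcomb s) f = \sum_(x <- s) x.1 * (f x.2)^*.
Proof.
move=> Af; rewrite /kcomb (ip_suml subA ipA) //; last first.
  by move=> x _; apply: (subZV subA); exact: kerA.
apply: eq_bigr => x _; rewrite (ipZl subA ipA) //; last exact: kerA.
by rewrite reproducing_l.
Qed.

Lemma nsq_kcomb s : nsq ip (kcomb s) = re (qform K s).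
Proof.
have AK (x : C * D) : A (x.1 *: (K ^~ x.2 : pfun R)).
  by apply: (subZV subA); exact: kerA.
rewrite /nsq {1}/kcomb (ip_suml subA ipA) //; last exact: kcombA.
congr (re _); apply: eq_bigr => x _; rewrite (ip_sumr subA ipA) //.
apply: eq_bigr => y _; rewrite (ipZl subA ipA) ?(ipZr subA ipA) //; try exact: kerA.
by rewrite reproducing ?mulrA //; exact: kerA.
Qed.

Lemma kcomb_cat s t : kcomb (s ++ t) = kcomb s + kcomb t.
Proof. by rewrite /kcomb big_cat. Qed.

Definition kscale (a : C) s := [seq (a * x.1, x.2) | x <- s].

Lemma kcomb_scale a s : kcomb (kscale a s) = a *: kcomb s.
Proof.
by rewrite /kcomb big_map scaler_sumr; apply: eq_bigr => x _; rewrite /= scalerA.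
Qed.

(** The form of the rank-one kernel at [s] is the squared modulus of <kcomb s, f>, so this is the
    Cauchy-Schwarz inequality. *)
Lemma member_psd f : A f ->
  psd (fun z w => rC (nsq ip f) * K z w - f z * (f w)^*).
Proof.
move=> Af s; have -> : (fun z w : D => rC (nsq ip f) * K z w - f z * (f w)^*) =
    (fun z w => rC (nsq ip f) * K z w + (- 1) * (f z * (f w)^*)).
  by apply/funext => z; apply/funext => w; rewrite mulN1r.
rewrite qformD !qformZ qform_rank1 mul_conj mulN1r !cE mul0r subr0 -nsq_kcomb.
rewrite -ip_kcombl // subr_ge0 mulrC; apply: (cauchy_schwarz subA ipA) => //.
exact: kcombA.
Qed.

(* f is recovered as the limit of a minimizing sequence of the functional
   g |-> nsq g - 2 Re <g, f> over the span of the kernel functions, where <g, f>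
   makes sense before f is known to belong to A. *)
Lemma psd_member f (c : R) : 0 <= c ->
  psd (fun z w => rC c * K z w - f z * (f w)^*) -> A f /\ nsq ip f <= c.
Proof.
move=> c0 psdf; pose l s := \sum_(x <- s) x.1 * (f x.2)^*.
have lD s t : l (s ++ t) = l s + l t by rewrite /l big_cat.
have lZ a s : l (kscale a s) = a * l s.
  by rewrite /l big_map big_distrr; apply: eq_bigr => x _ /=; rewrite mulrA.
have lle s : sqn (l s) <= c * nsq ip (kcomb s).
  have := psdf s; have -> : (fun z w : D => rC c * K z w - f z * (f w)^*) =
      (fun z w => rC c * K z w + (- 1) * (f z * (f w)^*)).
    by apply/funext => z; apply/funext => w; rewrite mulN1r.
  rewrite qformD !qformZ qform_rank1 mul_conj mulN1r !cE mul0r subr0 -nsq_kcomb.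
  by rewrite subr_ge0.
pose J s := nsq ip (kcomb s) - 2 * re (l s).
(* With n the squared norm of [kcomb s], 2 Re (l s) <= 2 sqrt (c n) <= n + c; the argument is
   carried out on squares. *)
have Jc s : - c <= J s.
  have := lle s; have := nsq_ge0 subA ipA (kcombA s); rewrite /J /sqn.
  move: (nsq _ _) (re _) (im _) => n a b n0 h.
  have : 4 * a ^+ 2 <= (n + c) ^+ 2 by have := sqr_ge0 (n - c); have := sqr_ge0 b; nra.
  move=> h2; suff : 2 * a <= n + c by lra.
  apply: contraTT h2; rewrite -!ltNge => h3.
  have : 0 < (2 * a - (n + c)) * (2 * a + (n + c)) by rewrite mulr_gt0 //; lra.
  lra.
pose E := [set J s | s in setT].
have hE : has_inf E.
  split; first by exists (J [::]), [::].
  by exists (- c) => _ [s _ <-].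
pose m := inf E.
have mJ s : m <= J s by apply: ge_inf; [case: hE | exists s].
have Jm (n : nat) : exists s, J s < m + n.+1%:R^-1.
  have [|_ [s _ <-] ?] := inf_adherent _ hE (eps := n.+1%:R^-1); first by rewrite invr_gt0 ltr0Sn.
  by exists s.
have [u Ju] := choice Jm.
(* Parallelogram identity: J at the midpoint of [s] and [t] equals (J s + J t) / 2 minus a quarter
   of the left-hand side, and it is at least m. *)
have dist s t : nsq ip (kcomb s - kcomb t) <= 2 * (J s - m) + 2 * (J t - m).
  have := mJ (kscale (rC 2^-1) (s ++ t)).
  rewrite /J kcomb_scale lZ kcomb_cat lD.
  have As := kcombA s; have At := kcombA t.
  rewrite (nsqZ subA ipA) ?(nsqB subA ipA) ?(nsqD subA ipA) //; last exact: (subDV subA).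
  rewrite /sqn !cE /=; move: (nsq _ _) (nsq _ _) (re _) (re _) (re _) => *.
  lra.
have Aku n : A (kcomb (u n)) by exact: kcombA.
have [g Ag gu] : exists2 g, A g & forall e : R, 0 < e ->
    exists N, forall n, (N <= n)%N -> nsq ip (kcomb (u n) - g) < e.
  case: hilA => _ _ /(completeP A ip); apply => // e e0.
  have [|N NP] := @natSinv_lt R (e / 4); first by lra.
  exists N => a b /NP Na /NP Nb; apply: le_lt_trans (dist _ _) _.
  by move: Na Nb (Ju a) (Ju b); move: (a.+1%:R^-1) (b.+1%:R^-1) (J _) (J _) => *; lra.
have fg : f = g.
  apply/funext => w; apply/eqP; rewrite -subr_eq0; apply/eqP.
  pose k := re (K w w); have k0 : 0 <= k.
    have := nsq_ge0 subA ipA (kerA w); rewrite /nsq reproducing //; exact: kerA.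
  (* Near-minimality of [u n] is tested against adding - d / (k + 1) times K(., w), where d is the
     error at w. This changes J by |d|^2 (k / (k + 1)^2 - 2 / (k + 1)) <= - |d|^2 / (k + 1), while J
     cannot drop by more than 1 / (n + 1). The summand 1 in k + 1 covers the case k = 0. *)
  have dn n : sqn (kcomb (u n) w - f w) <= (k + 1) * n.+1%:R^-1.
    pose d := kcomb (u n) w - f w.
    have := mJ (kscale (rC (- (k + 1)^-1) * d) [:: (1, w)] ++ u n).
    rewrite /J kcomb_cat lD kcomb_scale lZ /l /kcomb !big_seq1 /= !scale1r -/(kcomb _).
    rewrite (nsqP subA ipA) //; last exact: kerA.
    rewrite reproducing_l // mul1r -/(l (u n)).
    have -> : nsq ip (K^~ w) = k by rewrite /nsq reproducing //; exact: kerA.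
    rewrite sqnM.
    have -> : re (rC (- (k + 1)^-1) * d * (kcomb (u n) w)^*) =
       - (k + 1)^-1 * sqn d + re (rC (- (k + 1)^-1) * d * (f w)^*).
      have e : d = kcomb (u n) w - f w by [].
      have -> : kcomb (u n) w = d + f w by rewrite e subrK.
      by rewrite /sqn !cE; ring.
    have -> : sqn (rC (- (k + 1)^-1) : C) = (k + 1)^-1 ^+ 2 by rewrite /sqn !cE; ring.
    rewrite [re (_ + l _)]reD; have := Ju n; rewrite /J.
    move: (re (rC _ * _ * _)) (nsq _ _) (re (l _)) (n.+1%:R^-1) => X N L i.
    have := sqn_ge0 d; move: (sqn d) => q q0 h1.
    move=> h2.
    have k1 : 0 < k + 1 by lra.
    have e1 : (k + 1)^-1 ^+ 2 * q * k <= (k + 1)^-1 * q.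
      rewrite expr2 -!mulrA ler_pM2l ?invr_gt0 // [_ * (q * k)]mulrC -mulrA.
      by rewrite ler_piMr // ler_pdivrMr //; lra.
    have h3 : (k + 1)^-1 * q < i by lra.
    by rewrite ltW // -ltr_pdivrMl.
  apply: sqn_eq0; apply/ler_addgt0Pr => e e0; rewrite add0r.
  have [|N1 H1] := @natSinv_lt R (e / (4 * (k + 1))); first by rewrite divr_gt0 //; lra.
  have [|N2 H2] := gu (e / (4 * (k + 1))); first by rewrite divr_gt0 //; lra.
  pose n := maxn N1 N2; have := dn n.
  have := H1 n (leq_maxl _ _); have := H2 n (leq_maxr _ _).
  have k1 : 0 < 4 * (k + 1) by lra.
  rewrite !ltr_pdivlMr //; move: (n.+1%:R^-1) => i h1 h2 h3.
  have Ad : A (kcomb (u n) - g) by exact: (subBV subA).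
  have := cauchy_schwarz subA ipA Ad (kerA w).
  rewrite reproducing // [nsq _ (K^~ w)]/nsq reproducing; last exact: kerA.
  rewrite -/k => h4.
  have h5 : sqn (f w - g w) <= 2 * sqn (kcomb (u n) w - f w) + 2 * sqn ((kcomb (u n) - g) w).
    have -> : (kcomb (u n) - g) w = kcomb (u n) w - g w by [].
    rewrite /sqn !cE; move: (re _) (im _) (re _) (im _) (re _) (im _) => a b a' b' x y.
    have := sqr_ge0 (x + a' - 2 * a); have := sqr_ge0 (y + b' - 2 * b); lra.
  nra.
split; rewrite fg //.
(* Now that f is in A, l is the inner product with f, so the squared distance from [kcomb (u N)] to
   f is J (u N) + nsq f, and J is at least - c. *)
apply/ler_addgt0Pr => e e0; have [N /(_ N (leqnn _))] := gu e e0.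
rewrite (nsqB subA ipA) //; have := Jc (u N); rewrite /J.
by rewrite /l -fg -ip_kcombl fg //; lra.
Qed.

(** Invariance of K transports the positivity criterion along phi, so composition with phi does not
    increase norms. The inverse map gives the reverse inequality, and polarization passes to inner
    products. *)
Lemma ip_kernel_map f g (phi psi : D -> D) : cancel phi psi -> cancel psi phi ->
  (forall z w, K (phi z) (phi w) = K z w) -> A f -> A g ->
  A (fun z => f (phi z)) /\
  ip ((fun z => f (phi z)) : pfun R) (fun z => g (phi z)) = ip f g.
Proof.
move=> phiK psiK Kphi.
have half phi' h : (forall z w, K (phi' z) (phi' w) = K z w) -> A h ->
    A (fun z => h (phi' z)) /\ nsq ip (fun z => h (phi' z)) <= nsq ip h.
  move=> Kphi' Ah; apply: psd_member => [|s]; first exact: (nsq_ge0 subA ipA).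
  have := member_psd Ah [seq (x.1, phi' x.2) | x <- s].
  rewrite /qform big_map; congr (0 <= re _).
  by apply: eq_bigr => x _; rewrite big_map; apply: eq_bigr => y _; rewrite /= Kphi'.
have Kpsi z w : K (psi z) (psi w) = K z w by rewrite -[LHS]Kphi !psiK.
have nsqphi h : A h -> nsq ip (fun z => h (phi z)) = nsq ip h.
  move=> Ah; have [Ah1 le1] := half _ _ Kphi Ah; have [Ah2 le2] := half _ _ Kpsi Ah1.
  apply/eqP; rewrite eq_le le1 /=; congr (nsq ip _ <= _): le2.
  by apply/funext => z; rewrite psiK.
move=> Af Ag; have [Af1 _] := half _ _ Kphi Af; have [Ag1 _] := half _ _ Kphi Ag.
split=> //; apply: (polarization subA ipA) => // a.
by rewrite -[RHS]nsqphi //; exact: (subPV subA).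
Qed.

End RKHS.
End Kernels.

(** * The complex binomial series *)

Section ComplexLimits.
Variable R : realType.
Local Notation C := (Cx R).

(** Convergence by real and imaginary parts, so that only limits of real sequences occur; [is_cder]
    does the same for derivatives in a real variable. *)
Definition ccvg (u : nat -> C) (l : C) :=
  (re (u n) @[n --> \oo] --> re l) /\ (im (u n) @[n --> \oo] --> im l).

Lemma ccvg_cst l : ccvg (fun=> l) l.
Proof. by split; apply: cvg_cst. Qed.

Lemma ccvgD u v l m : ccvg u l -> ccvg v m -> ccvg (fun n => u n + v n) (l + m).
Proof.
move=> [u1 u2] [v1 v2]; split; rewrite cE;
  under eq_fun do rewrite cE; exact: cvgD.
Qed.

Lemma ccvgM u v l m : ccvg u l -> ccvg v m -> ccvg (fun n => u n * v n) (l * m).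
Proof.
move=> [u1 u2] [v1 v2]; split; rewrite cE; under eq_fun do rewrite cE.
  by apply: cvgB; apply: cvgM.
by apply: cvgD; apply: cvgM.
Qed.

Lemma ccvg_sum (I : Type) (s : seq I) (u : I -> nat -> C) l :
  (forall i, ccvg (u i) (l i)) ->
  ccvg (fun n => \sum_(i <- s) u i n) (\sum_(i <- s) l i).
Proof.
move=> h; elim: s => [|i s IH].
  by under eq_fun do rewrite big_nil; rewrite big_nil; apply: ccvg_cst.
by under eq_fun do rewrite big_cons; rewrite big_cons; apply: ccvgD.
Qed.

Lemma ccvg_shift u l : ccvg (fun n => u n.+1) l -> ccvg u l.
Proof. by move=> [h1 h2]; split; rewrite -(cvg_shiftS (fun n => _ (u n))). Qed.

Lemma ccvg_eventually u v l N : (forall n, (N <= n)%N -> u n = v n) ->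
  ccvg u l -> ccvg v l.
Proof.
by move=> uv [h1 h2]; split; [apply: cvg_trans h1 | apply: cvg_trans h2];
  apply: near_eq_cvg; exists N => // n /= Nn; rewrite uv.
Qed.

Lemma ccvg_prod (I : Type) (s : seq I) (u : I -> nat -> C) l :
  (forall i, ccvg (u i) (l i)) ->
  ccvg (fun n => \prod_(i <- s) u i n) (\prod_(i <- s) l i).
Proof.
move=> h; elim: s => [|i s IH].
  by under eq_fun do rewrite big_nil; rewrite big_nil; apply: ccvg_cst.
by under eq_fun do rewrite big_cons; rewrite big_cons; apply: ccvgM.
Qed.

Definition is_cder (f : R -> C) (t : R) (d : C) :=
  is_derive t (1 : R) (fun t => re (f t)) (re d) /\
  is_derive t (1 : R) (fun t => im (f t)) (im d).

Lemma is_cder_eq f t d d' : is_cder f t d -> d = d' -> is_cder f t d'.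
Proof. by move=> h <-. Qed.

Lemma is_cder_cst c t : is_cder (fun=> c) t 0.
Proof. by split; apply: is_derive_cst. Qed.

Lemma is_cder_line (v : C) t : is_cder (fun t => rC t * v) t v.
Proof.
have e1 : (fun t => re (rC t * v)) = (fun t => re v * t) by apply/funext => s; rewrite !cE; ring.
have e2 : (fun t => im (rC t * v)) = (fun t => im v * t) by apply/funext => s; rewrite !cE; ring.
by split; rewrite ?e1 ?e2; apply: is_derive_eq; rewrite /GRing.scale /= mulr1 ?mulr0 ?addr0.
Qed.

Lemma is_cderD f g t d e : is_cder f t d -> is_cder g t e ->
  is_cder (fun t => f t + g t) t (d + e).
Proof.
move=> [f1 f2] [g1 g2]; split; rewrite cE; under eq_fun do rewrite cE;
  exact: is_deriveD.
Qed.

Lemma is_cderM f g t d e : is_cder f t d -> is_cder g t e ->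
  is_cder (fun t => f t * g t) t (d * g t + f t * e).
Proof.
move=> [f1 f2] [g1 g2]; split; rewrite !cE; under eq_fun do rewrite cE;
  apply: is_derive_eq; rewrite /GRing.scale /=; ring.
Qed.

Lemma is_cderX f t d n : is_cder f t d ->
  is_cder (fun t => f t ^+ n) t (n%:R * f t ^+ n.-1 * d).
Proof.
move=> fd; elim: n => [|n IH].
  apply: (is_cder_eq (d := 0)); last by rewrite !mul0r.
  exact: is_cder_cst.
under [fun t => _]eq_fun do rewrite exprS.
apply: is_cder_eq; first exact: is_cderM fd IH.
case: n {IH} => [|n]; first by rewrite /=; ring.
rewrite /= -(natr1 n.+1) exprS. ring.
Qed.

Lemma is_cder_sum n (f : nat -> R -> C) d t : (forall i, is_cder (f i) t (d i)) ->
  is_cder (fun t => \sum_(i < n) f i t) t (\sum_(i < n) d i).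
Proof.
move=> h; elim: n => [|n IH].
  by under eq_fun do rewrite big_ord0; rewrite big_ord0; apply: is_cder_cst.
under eq_fun do rewrite big_ord_recr; rewrite big_ord_recr /=.
by apply: is_cderD.
Qed.

Lemma mvt_sqr (f df : R -> R) (M : R) :
  (forall t : R, 0 <= t -> t <= 1 -> is_derive t (1 : R) f (df t)) ->
  (forall t : R, 0 <= t -> t <= 1 -> df t ^+ 2 <= M) -> (f 1 - f 0) ^+ 2 <= M.
Proof.
move=> fd dM; have [||c] := @MVT R f df 0 1 ltr01.
- by move=> x; rewrite in_itv => /andP[x0 x1]; apply: fd; exact: ltW.
- apply: derivable_within_continuous => x; rewrite in_itv => /andP[x0 x1].
  by apply: ex_derive; apply: fd.
rewrite in_itv => /andP[c0 c1] ->; rewrite subr0 mulr1; apply: dM; exact: ltW.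
Qed.

Lemma sqr_cvg0 (u b : nat -> R) : b @ \oo --> 0 -> (forall n, u n ^+ 2 <= b n) ->
  u @ \oo --> 0.
Proof.
move=> b0 ub; apply/cvgr0Pnorm_lt => e e0.
have /cvgr0Pnorm_lt /(_ (e ^+ 2) (exprn_gt0 _ e0)) := b0.
apply: filterS => n bn; rewrite -(@ltr_pXn2r _ 2) ?nnegrE ?normr_ge0 //; last exact: ltW.
rewrite real_normK ?num_real //; apply: le_lt_trans (ub n) _.
exact: le_lt_trans (ler_norm _) bn.
Qed.

End ComplexLimits.

(** * Coefficients and partial sums of the binomial series *)

Section BinomialSeries.
Variables (R : realType) (lambda : R).
Hypothesis lambda0 : 0 < lambda.
Local Notation C := (Cx R).

Definition bcoef n : R := \prod_(k < n) ((lambda + k%:R) / k.+1%:R).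

Lemma bcoef0 : bcoef 0 = 1. Proof. by rewrite /bcoef big_ord0. Qed.
Lemma bcoefS n : bcoef n.+1 = bcoef n * ((lambda + n%:R) / n.+1%:R).
Proof. by rewrite /bcoef big_ord_recr. Qed.
Lemma bcoefSM n : n.+1%:R * bcoef n.+1 = (lambda + n%:R) * bcoef n.
Proof. by rewrite bcoefS; field; rewrite addrC natr1 pnatr_eq0. Qed.
Lemma bcoef_gt0 n : 0 < bcoef n.
Proof.
apply: prodr_gt0 => k _; apply: divr_gt0; last by rewrite ltr0Sn.
by apply: ltr_wpDr => //; rewrite ler0n.
Qed.

Definition bsum (N : nat) (u : C) : C := \sum_(n < N) rC (bcoef n) * u ^+ n.

(** Ratio test: the quotient of consecutive terms is ((lambda + n) / n)^2 q, eventually at most (1 +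
    q) / 2 < 1. The coefficient is squared because errors are measured by [sqn]. *)
Lemma bcoef_bound (q : R) : 0 <= q -> q < 1 ->
  (fun n => (n%:R * bcoef n) ^+ 2 * q ^+ n) @ \oo --> 0.
Proof.
move=> q0 q1; pose b n := (n%:R * bcoef n) ^+ 2 * q ^+ n.
pose r := (1 + q) / 2; have r0 : 0 <= r by rewrite /r; lra.
have r1 : r < 1 by rewrite /r; lra.
(* From n0 on, lambda <= n (1 - q) / 6, and (1 + (1 - q) / 6)^2 q <= (1 + q) / 2 for 0 <= q < 1. *)
pose n0 := (Num.bound (6 * lambda / (1 - q))).+1.
have bn0 n : 0 <= b n by rewrite mulr_ge0 ?sqr_ge0 ?exprn_ge0.
have step n : (n0 <= n)%N -> b n.+1 <= r * b n.
  move=> nn; have nl : 6 * lambda / (1 - q) < n%:R.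
    apply: lt_le_trans (archi_boundP _) _.
      by rewrite divr_ge0 ?mulr_ge0 // ?subr_ge0 ltW.
    by rewrite ler_nat; apply: leq_trans nn; rewrite /n0.
  rewrite ltr_pdivrMr ?subr_gt0 // in nl.
  rewrite /b bcoefSM (exprS q) !exprMn.
  have n1 : 1 <= n%:R :> R by rewrite ler1n; apply: leq_trans nn.
  have h : (lambda + n%:R) ^+ 2 * q <= r * n%:R ^+ 2.
    rewrite /r; move: (n%:R) nl n1 => x nl n1.
    have : lambda + x <= x * (1 + (1 - q) / 6) by lra.
    move=> h1; apply: (@le_trans _ _ ((x * (1 + (1 - q) / 6)) ^+ 2 * q)).
      rewrite ler_wpM2r // ler_pXn2r // ?nnegrE ?addr_ge0 ?mulr_ge0 ?ltW //; lra.
    have h2 : (1 + (1 - q) / 6) ^+ 2 * q <= (1 + q) / 2 by nra.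
    have -> : (x * (1 + (1 - q) / 6)) ^+ 2 * q = x ^+ 2 * ((1 + (1 - q) / 6) ^+ 2 * q).
      by ring.
    by rewrite [X in _ <= X]mulrC ler_wpM2l ?sqr_ge0.
  have -> : (lambda + n%:R) ^+ 2 * bcoef n ^+ 2 * (q * q ^+ n) =
      (lambda + n%:R) ^+ 2 * q * (bcoef n ^+ 2 * q ^+ n) by ring.
  have -> : r * (n%:R ^+ 2 * bcoef n ^+ 2 * q ^+ n) =
      r * n%:R ^+ 2 * (bcoef n ^+ 2 * q ^+ n) by ring.
  apply: ler_wpM2r => //.
  by rewrite mulr_ge0 ?sqr_ge0 ?exprn_ge0.
have bk k : b (k + n0)%N <= r ^+ k * b n0.
  elim: k => [|k IH]; first by rewrite expr0 mul1r.
  rewrite addSn exprS -mulrA; apply: le_trans (step _ _) _; first exact: leq_addl.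
  by rewrite ler_wpM2l.
rewrite -(cvg_shiftn n0); apply: (@squeeze_cvgr _ _ _ _ (fun=> 0) (fun k => r ^+ k * b n0)).
- by apply: nearW => k; rewrite bn0 bk.
- exact: cvg_cst.
- rewrite -(mul0r (b n0)); apply: cvgMl.
  by apply: cvg_expr; rewrite ger0_norm.
Qed.

(** * The series along the segment from 0 to v *)

Section Ray.
Variable v : C.
Hypothesis v1 : sqn v < 1.

Let x (t : R) : R := 1 - t * re v.
Let y (t : R) : R := - (t * im v).

(** The recurrence [bcoefSM] cancels all terms of the differential equation except the one of top
    degree N in t v. *)
Lemma bsum_cder N t : exists2 d : C, is_cder (fun t => bsum N.+1 (rC t * v)) t d &
  (1 - rC t * v) * d = rC lambda * v * bsum N.+1 (rC t * v)
    - rC (N.+1%:R * bcoef N.+1) * v * (rC t * v) ^+ N.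
Proof.
exists (\sum_(n < N.+1) rC (bcoef n) * (n%:R * (rC t * v) ^+ n.-1 * v)).
  apply: (@is_cder_sum _ N.+1 (fun n t => rC (bcoef n) * (rC t * v) ^+ n)
    (fun n => rC (bcoef n) * (n%:R * (rC t * v) ^+ n.-1 * v))) => n.
  apply: is_cder_eq; first exact: is_cderM (is_cder_cst _ _) (is_cderX _ (is_cder_line _ _)).
  by rewrite mul0r add0r.
elim: N => [|N IH].
  by rewrite /bsum !big_ord1 /= bcoefSM bcoef0 !rCM rCD rC_nat rC1; ring.
rewrite /bsum big_ord_recr [in RHS]big_ord_recr /= !mulrDr IH.
rewrite (bcoefSM N.+1) !rCM rCD !rC_nat -/(bsum _ _) !exprS.
by move: (rC t * v) => u; rewrite -(natr1 N); ring.
Qed.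

Let x0 t : 0 <= t -> t <= 1 -> 0 < x t.
Proof.
move=> t0 t1; have r1 : re v < 1 by move: v1; rewrite /sqn; nra.
rewrite /x; have [rv|rv] := lerP 0 (re v); last by nra.
by have := ler_wpM2r rv t1; lra.
Qed.

Let n0 t : 0 <= t -> t <= 1 -> 0 < x t ^+ 2 + y t ^+ 2.
Proof. by move=> t0 t1; have := x0 t0 t1; have := sqr_ge0 (y t); nra. Qed.

(** This is (1 - t v)^lambda with its modulus written as a power of x^2 + y^2, so that no square
    root has to be differentiated. *)
Let E (t : R) : C :=
  let m := (x t ^+ 2 + y t ^+ 2) `^ (lambda / 2) in
  let a := lambda * atan (y t / x t) in Complex (m * cos a) (m * sin a).

Let cpowE t : cpow (1 - rC t * v) lambda = E t.
Proof.
rewrite /cpow /E.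
have e1 : complex.Re (1 - rC t * v) = x t by rewrite -/(re _) /x !cE; ring.
have e2 : complex.Im (1 - rC t * v) = y t by rewrite -/(im _) /y !cE; ring.
have -> : Normc.normc (1 - rC t * v) `^ lambda = (x t ^+ 2 + y t ^+ 2) `^ (lambda / 2).
  rewrite [lambda / 2]mulrC powRrM powR12_sqrt ?addr_ge0 ?sqr_ge0 // -e1 -e2.
  by case: (1 - rC t * v).
by rewrite e1 e2.
Qed.

Let E_cder t : 0 <= t -> t <= 1 ->
  exists2 d : C, is_cder E t d & (1 - rC t * v) * d = - rC lambda * v * E t.
Proof.
move=> t0 t1; have xt := x0 t0 t1; have nt := n0 t0 t1.
have dx : is_derive t (1 : R) x (- re v).
  rewrite /x; apply: is_derive_eq; rewrite /GRing.scale /=; ring.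
have dy : is_derive t (1 : R) y (- im v).
  by rewrite /y; apply: is_derive_eq; rewrite /GRing.scale /=; ring.
pose n t := x t ^+ 2 + y t ^+ 2.
have dn : is_derive t (1 : R) n (- 2 * (x t * re v + y t * im v)).
  by rewrite /n; apply: is_derive_eq; rewrite /GRing.scale /=; ring.
have dm : is_derive t (1 : R) (fun t => n t `^ (lambda / 2))
    (- lambda / n t * (x t * re v + y t * im v) * n t `^ (lambda / 2)).
  have dp := @is_derive1_powR R (lambda / 2) (n t) nt.
  apply: is_derive_eq; first exact: (is_derive1_comp dp dn).
  have -> : n t `^ (lambda / 2 - 1) = n t `^ (lambda / 2) / n t.
    have nn0 : n t != 0 by rewrite gt_eqF.
    by rewrite powRD ?nn0 ?implybT // powRN powRr1 // ltW.
  by rewrite /GRing.scale /=; field; rewrite /n gt_eqF.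
have da : is_derive t (1 : R) (fun t => lambda * atan (y t / x t))
    (lambda / n t * (y t * re v - x t * im v)).
  have dV : is_derive t (1 : R) (fun t => (x t)^-1) (- (x t) ^- 2 * (- re v)).
    by apply: is_derive_eq; [apply: is_deriveV; rewrite gt_eqF | rewrite /GRing.scale].
  have dq : is_derive t (1 : R) (fun t => y t / x t) ((y t * re v - x t * im v) / x t ^+ 2).
    by apply: is_derive_eq; rewrite /GRing.scale /=; field; rewrite gt_eqF.
  have dt := @is_derive1_comp R atan (fun t => y t / x t) t _ _ (is_derive1_atan _) dq.
  apply: is_derive_eq; rewrite /n.
  have xn0 : x t != 0 by rewrite gt_eqF.
  have nn0 : x t ^+ 2 + y t ^+ 2 != 0 by rewrite gt_eqF.
  by rewrite /GRing.scale /=; field; rewrite xn0 nn0.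
pose cc := n t `^ (lambda / 2) * cos (lambda * atan (y t / x t)).
pose ss := n t `^ (lambda / 2) * sin (lambda * atan (y t / x t)).
(* p + i w is - v times the conjugate of 1 - t v, hence - v / (1 - t v) = (p + i w) / n t. *)
pose p := - (x t * re v + y t * im v); pose w := y t * re v - x t * im v.
exists (Complex (lambda / n t * (p * cc - w * ss)) (lambda / n t * (p * ss + w * cc))).
  have dc := @is_derive1_comp R cos (fun t => lambda * atan (y t / x t)) t _ _ (is_derive_cos _) da.
  have ds := @is_derive1_comp R sin (fun t => lambda * atan (y t / x t)) t _ _ (is_derive_sin _) da.
  split; rewrite /E /re /im /=; apply: is_derive_eq; rewrite /GRing.scale /= /p /w /cc /ss;
  by field; rewrite gt_eqF.
have nn0 : n t != 0 by rewrite gt_eqF.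
have e1 : re (1 - rC t * v) = x t by rewrite /x !cE; ring.
have e2 : im (1 - rC t * v) = y t by rewrite /y !cE; ring.
have e3 : re (E t) = cc by []. have e4 : im (E t) = ss by [].
have nE : n t = x t ^+ 2 + y t ^+ 2 by [].
by apply: ceqP; [rewrite [LHS]reM | rewrite [LHS]imM]; rewrite e1 e2 !cE e3 e4;
  rewrite /re /im /= -/(re v) -/(im v) /p /w nE; field.
Qed.

Let E_sqn t : sqn (E t) = (x t ^+ 2 + y t ^+ 2) `^ lambda.
Proof.
have e : lambda = lambda / 2 + lambda / 2 by lra.
rewrite [in RHS]e powRD; last by rewrite -e gt_eqF.
rewrite /sqn /E /re /im /= !exprMn -mulrDr cos2Dsin2 mulr1.
by rewrite expr2.
Qed.

Let E_V : cpow (1 - v) (- lambda) * E 1 = 1.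
Proof.
have -> : cpow (1 - v) (- lambda) = cpow (1 - rC 1 * v) (- lambda) by rewrite rC1 mul1r.
rewrite -cpowE /cpow mulNr cosN sinN powRN.
have : 0 < Normc.normc (1 - rC 1 * v) `^ lambda.
  apply: powR_gt0; have := x0 ler01 (lexx 1); have -> : x 1 = re (1 - rC 1 * v).
    by rewrite /x !cE; ring.
  case: (1 - rC 1 * v) => a b /= a0; rewrite sqrtr_gt0; rewrite /re /= in a0; nra.
move: (_ `^ _) (lambda * _) => r a r0; have := cos2Dsin2 a => h.
apply: ceqP; rewrite ?reM ?imM /re /im /=.
  transitivity (cos a ^+ 2 + sin a ^+ 2) => //; field; rewrite gt_eqF //.
by field; rewrite gt_eqF.
Qed.

(* S_N = sum_(n < N) a_n u^n satisfies (1 - u) S_N' = lambda S_N up to a term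
   N a_N u^(N-1), so the derivative of t |-> (1 - t v)^lambda S_N (t v) tends to 0
   uniformly on [0, 1] and the mean value theorem applies. *)
Lemma binomial_series : ccvg (bsum ^~ v) (cpow (1 - v) (- lambda)).
Proof.
(* On the segment |1 - t v| lies between 1 - |Re v| and 2; this bounds the factor E t / (1 - t v) of
   the error term. *)
pose M := 4 `^ lambda / (1 - `|re v|) ^+ 2.
pose b n := M * ((n%:R * bcoef n) ^+ 2 * sqn v ^+ n).
pose G N t := E t * bsum N.+1 (rC t * v).
pose err N t := - (E t / (1 - rC t * v) * rC (N.+1%:R * bcoef N.+1) * v * (rC t * v) ^+ N).
have wn0 t : 0 <= t -> t <= 1 -> 1 - rC t * v != 0.
  move=> t0 t1; apply/eqP => /(congr1 (@re R)); rewrite !cE.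
  by have := x0 t0 t1; rewrite /x => h1 h2; lra.
have Gd N t : 0 <= t -> t <= 1 -> is_cder (G N) t (err N t).
  move=> t0 t1; have [d1 Ed d1E] := E_cder t0 t1; have [d2 Sd d2E] := bsum_cder N t.
  apply: is_cder_eq; first exact: is_cderM Ed Sd.
  apply: (mulfI (wn0 t t0 t1)); rewrite mulrDr mulrA d1E [E t * d2]mulrC mulrA d2E /err.
  by field; rewrite wn0.
have errM N t : 0 <= t -> t <= 1 -> sqn (err N t) <= b N.+1.
  move=> t0 t1; have k0 := n0 t0 t1.
  have e1 : sqn (1 - rC t * v) = x t ^+ 2 + y t ^+ 2.
    by rewrite /sqn /x /y !cE; ring.
  have rv1 : `|re v| < 1.
    rewrite -(@ltr_pXn2r _ 2) ?nnegrE // expr1n real_normK ?num_real //.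
    by apply: le_lt_trans v1; rewrite /sqn lerDl sqr_ge0.
  have trv : `|t * re v| <= `|re v| by rewrite normrM ger0_norm // ler_piMl.
  rewrite /err -mulN1r !sqnM sqnV sqnX !sqnM e1 E_sqn !sqn_rC exprMn.
  have -> : sqn (-1 : C) = 1 by rewrite /sqn !cE; ring.
  have h1 : (x t ^+ 2 + y t ^+ 2) `^ lambda <= 4 `^ lambda.
    apply: ge0_ler_powR; rewrite ?nnegrE ?ltW // -e1 /sqn !cE.
    move: trv v1; rewrite /sqn ler_norml => /andP[h2 h3] h4.
    have : t ^+ 2 * (re v ^+ 2 + im v ^+ 2) <= 1.
      by rewrite mulr_ile1 ?sqn_ge0 ?exprn_ile1 ?sqr_ge0 // ltW.
    by lra.
  have h2 : (x t ^+ 2 + y t ^+ 2)^-1 <= (1 - `|re v|) ^- 2.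
    have p0 : 0 < 1 - `|re v| by rewrite subr_gt0.
    rewrite lef_pV2 ?posrE ?exprn_gt0 //; apply: ler_wpDr; first exact: sqr_ge0.
    rewrite ler_pXn2r ?nnegrE ?(ltW p0) ?(ltW (x0 t0 t1)) //.
    by rewrite /x; move: trv; rewrite ler_norml => /andP[_ ?]; lra.
  have h3 : (t ^+ 2) ^+ N <= 1 by rewrite !exprn_ile1 // exprn_ge0.
  rewrite /b /M mul1r (exprS (sqn v)) (exprMn _ (t ^+ 2)).
  have i0 : 0 <= (x t ^+ 2 + y t ^+ 2)^-1 by rewrite invr_ge0 ltW.
  have P0 := powR_ge0 (x t ^+ 2 + y t ^+ 2) lambda.
  have T0 : 0 <= (t ^+ 2) ^+ N by rewrite !exprn_ge0.
  have Q0 : 0 <= sqn v ^+ N by rewrite exprn_ge0 // sqn_ge0.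
  have K0 : 0 <= N.+1%:R ^+ 2 * bcoef N.+1 ^+ 2 * sqn v.
    by apply: mulr_ge0; [apply: mulr_ge0; exact: sqr_ge0 | exact: sqn_ge0].
  move: ((t ^+ 2) ^+ N) h3 T0 => T h3 T0; rewrite !exprMn.
  move: (_ `^ _) (4 `^ _) (_^-1) (_ ^- 2) (sqn v ^+ N) (N.+1%:R ^+ 2) h1 h2 i0 P0 Q0 K0.
  move=> P P' i i' Q k h1 h2 i0 P0 Q0 K0.
  have -> : P * i * (k * bcoef N.+1 ^+ 2) * sqn v * (T * Q) =
    P * i * (k * bcoef N.+1 ^+ 2 * sqn v * (T * Q)) by ring.
  have -> : P' * i' * (k * bcoef N.+1 ^+ 2 * (sqn v * Q)) =
    P' * i' * (k * bcoef N.+1 ^+ 2 * sqn v * Q) by ring.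
  apply: ler_pM; [exact: mulr_ge0 | by apply: mulr_ge0 => //; exact: mulr_ge0 | exact: ler_pM |].
  by rewrite ler_wpM2l // ler_piMl.
have d0 (f : C -> R) : (f = @re R) \/ (f = @im R) -> (fun N => f (G N 1) - f (G N 0)) @ \oo --> 0.
  move=> fE; apply: (@sqr_cvg0 _ _ (fun N => b N.+1)).
    have h := cvgM (cvg_cst M) (bcoef_bound (sqn_ge0 v) v1).
    have {}h := h _ _; rewrite mulr0 in h.
    by rewrite (cvg_shiftS b); exact: h.
  move=> N; apply: (@mvt_sqr _ (fun t => f (G N t)) (fun t => f (err N t))) => t t0 t1.
    by case: fE => ->; case: (Gd N t t0 t1).
  apply: le_trans (errM N t t0 t1); rewrite /sqn.
  by case: fE => ->; [rewrite lerDl|rewrite lerDr]; rewrite sqr_ge0.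
have G0 N : G N 0 = 1.
  rewrite /G rC0 mul0r /bsum big_ord_recl big1 => [|i _]; last by rewrite expr0n mulr0.
  rewrite addr0 bcoef0 expr0 mulr1 rC1 mulr1 /E /x /y !mul0r subr0 oppr0 mul0r atan0 mulr0.
  by rewrite cos0 sin0 expr1n expr0n addr0 powR1 mulr1 mulr0.
have G1 : ccvg (fun N => G N 1) 1.
  split; [have := d0 (@re R) (or_introl erefl) | have := d0 (@im R) (or_intror erefl)];
    under eq_fun do rewrite G0; last by under eq_fun do rewrite subr0.
  move=> h; rewrite -[re 1]add0r.
  have -> : (fun N => re (G N 1)) = (fun N => re (G N 1) - re (1 : C)) \+ (fun=> re (1 : C)).
    by apply/funext => N; rewrite /= subrK.
  by apply: cvgD h (cvg_cst _).
have : ccvg (fun N => cpow (1 - v) (- lambda) * G N 1) (cpow (1 - v) (- lambda) * 1).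
  by apply: ccvgM => //; apply: ccvg_cst.
under [fun N => _]eq_fun do rewrite /G mulrA E_V mul1r rC1 mul1r.
by rewrite mulr1; apply: ccvg_shift.
Qed.
End Ray.
End BinomialSeries.

(** * The weighted Bergman kernel *)

Section PsdClosure.
Variable R : realType.
Local Notation C := (Cx R).
Local Notation D := (polydisc R).
Implicit Types (k : D -> D -> C) (g : D -> C) (z w : D) (j : 'I_3).

Definition co z j : C := val z 0 j.

Lemma co_lt1 z j : sqn (co z j) < 1.
Proof. by rewrite -norm_lt1; have /forallP := valP z; apply. Qed.

Lemma co_mul_lt1 z w j : sqn (co z j * (co w j)^*) < 1.
Proof.
rewrite sqnM sqn_conj; have := co_lt1 z j; have := co_lt1 w j.
by have := sqn_ge0 (co z j); have := sqn_ge0 (co w j); nra.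
Qed.

Lemma psd_scale g k : psd k -> psd (fun z w => g z * (g w)^* * k z w).
Proof.
move=> kp s; have := kp [seq (x.1 * (g x.2)^*, x.2) | x <- s].
rewrite /qform big_map; congr (0 <= re _).
apply: eq_bigr => x _; rewrite big_map; apply: eq_bigr => y _ /=.
by rewrite rmorphM /= conjCK; ring.
Qed.

Lemma psdD k k' : psd k -> psd k' -> psd (fun z w => k z w + k' z w).
Proof. by move=> kp kp' s; rewrite qformD !cE addr_ge0. Qed.

Lemma psdZ (r : R) k : 0 <= r -> psd k -> psd (fun z w => rC r * k z w).
Proof. by move=> r0 kp s; rewrite qformZ !cE mul0r subr0 mulr_ge0. Qed.

Lemma psd1 : psd (fun _ _ : D => 1).
Proof.
move=> s; have -> : (fun _ _ : D => 1) = (fun z w : D => (fun=> 1) z * ((fun=> 1 : C) w)^*).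
  by apply/funext => z; apply/funext => w; rewrite conjC1 mulr1.
by rewrite qform_rank1 mul_conj re_rC sqn_ge0.
Qed.

Lemma psd_lim (k : nat -> D -> D -> C) l :
  (forall z w, ccvg (fun n => k n z w) (l z w)) -> (forall n, psd (k n)) -> psd l.
Proof.
move=> kl kp s; have [h _] : ccvg (fun n => qform (k n) s) (qform l s).
  by apply: ccvg_sum => x; apply: ccvg_sum => y; apply: ccvgM => //; exact: ccvg_cst.
by apply: (cvgr_to_ge h); apply: nearW => n; exact: kp.
Qed.

Definition series_kernel j k := exists b : nat -> R, (forall n, 0 <= b n) /\
  forall z w, ccvg (fun N => \sum_(n < N) rC (b n) * (co z j * (co w j)^*) ^+ n) (k z w).

(** The case of the Schur product theorem where one factor is a limit of sums of rank-one kernels: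
    each term of the series only rescales k, and sums and limits preserve positivity. *)
Lemma psd_series j l k : series_kernel j l -> psd k -> psd (fun z w => l z w * k z w).
Proof.
move=> [b [b0 bl]] kp.
apply: (@psd_lim (fun N z w => (\sum_(n < N) rC (b n) * (co z j * (co w j)^*) ^+ n) * k z w)).
  by move=> z w; apply: ccvgM => //; exact: ccvg_cst.
elim=> [|N IH] s.
  rewrite /qform; rewrite big1 => [|x _]; first by rewrite re0.
  by rewrite big1 => // y _; rewrite big_ord0 mul0r mulr0.
have -> : (fun z w => (\sum_(n < N.+1) rC (b n) * (co z j * (co w j)^*) ^+ n) * k z w) =
    (fun z w => (\sum_(n < N) rC (b n) * (co z j * (co w j)^*) ^+ n) * k z w +
      rC (b N) * (co z j ^+ N * (co w j ^+ N)^* * k z w)).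
  apply/funext => z; apply/funext => w.
  by rewrite big_ord_recr /= mulrDl exprMn rmorphXn /= -!mulrA.
by apply: psdD => //; apply: psdZ => //; apply: psd_scale.
Qed.

Lemma psd_prod (s : seq 'I_3) (l : 'I_3 -> D -> D -> C) :
  (forall j, series_kernel j (l j)) -> psd (fun z w => \prod_(j <- s) l j z w).
Proof.
move=> h; elim: s => [|j s IH].
  by under eq_fun do under eq_fun do rewrite big_nil; exact: psd1.
by under eq_fun do under eq_fun do rewrite big_cons; exact: psd_series.
Qed.

End PsdClosure.

Section BergmanKernel.
Variables (R : realType) (lambda : R).
Hypothesis lambda0 : 0 < lambda.
Local Notation C := (Cx R).
Local Notation D := (polydisc R).
Local Notation K := (bergman_kernel lambda).
Local Notation bcoef := (bcoef lambda).
Local Notation bsum := (bsum lambda).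
Implicit Types (z w : D) (j : 'I_3) (al be : 'I_3 -> nat).

Definition factor j z w : C := cpow (1 - co z j * (co w j)^*) (- lambda).

Lemma kernelE z w : K z w = \prod_j factor j z w.
Proof. by []. Qed.

Lemma factor_cvg j z w : ccvg (fun N => bsum N (co z j * (co w j)^*)) (factor j z w).
Proof. by apply: binomial_series => //; exact: co_mul_lt1. Qed.

Lemma factor_series j : series_kernel j (factor j).
Proof.
exists bcoef; split=> [n|z w]; first by rewrite ltW ?bcoef_gt0.
exact: factor_cvg.
Qed.

(** A constant M with a_n <= M a_(n+1) for all n, since a_n / a_(n+1) = (n + 1) / (lambda + n) <=
    max (1, 1 / lambda). *)
Definition mult_bound : R := 1 + lambda^-1.

Lemma mult_bound_ge0 : 0 <= mult_bound.
Proof. by rewrite addr_ge0 // invr_ge0 ltW. Qed.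

Lemma mult_factor_series j :
  series_kernel j (fun z w => (rC mult_bound - co z j * (co w j)^*) * factor j z w).
Proof.
exists (fun n => if n is m.+1 then mult_bound * bcoef m.+1 - bcoef m else mult_bound).
split=> [[|n]|z w]; first exact: mult_bound_ge0.
  have -> : mult_bound * bcoef n.+1 - bcoef n =
      bcoef n * ((lambda + n%:R / lambda) / n.+1%:R).
    by rewrite bcoefS /mult_bound -natr1; field; rewrite natr1 pnatr_eq0 (gt_eqF lambda0).
  rewrite mulr_ge0 ?ltW ?bcoef_gt0 // divr_gt0 ?ltr0Sn //.
  by apply: ltr_pwDl => //; rewrite divr_ge0 ?ler0n ?ltW.
set u := co z j * (co w j)^*.
apply: ccvg_shift.
have -> : (fun N => \sum_(n < N.+1) rC (if (n : nat) is m.+1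
      then mult_bound * bcoef m.+1 - bcoef m else mult_bound) * u ^+ n)
   = (fun N => rC mult_bound * bsum N.+1 u + (- u) * bsum N u).
  apply/funext; elim=> [|N IH].
    by rewrite /bsum !big_ord1 big_ord0 bcoef0 rC1 expr0 mulr0 addr0 !mulr1.
  rewrite big_ord_recr IH /= /bsum (big_ord_recr N.+1) (big_ord_recr N) /=.
  by move: mult_bound => m; rewrite rCD rCN rCM exprS; ring.
have h : ccvg (fun N => bsum N.+1 u) (factor j z w).
  have [h1 h2] := factor_cvg j z w.
  by split; rewrite (cvg_shiftS (fun n => _ (bsum n u))).
rewrite mulrBl -(mulNr u).
exact: ccvgD (ccvgM (ccvg_cst _) h) (ccvgM (ccvg_cst _) (factor_cvg j z w)).
Qed.

(** In kernel form, multiplication by z_i is bounded with squared norm at most [mult_bound]. Only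
    the factor of index i is modified, and it stays a series with nonnegative coefficients. *)
Lemma psd_mult i : psd (fun z w => (rC mult_bound - co z i * (co w i)^*) * K z w).
Proof.
pose l j z w := (if j == i then rC mult_bound - co z j * (co w j)^* else 1) * factor j z w.
have -> : (fun z w => (rC mult_bound - co z i * (co w i)^*) * K z w) =
    (fun z w => \prod_j l j z w).
  apply/funext => z; apply/funext => w; rewrite kernelE (bigD1 i) //= [RHS](bigD1 i) //=.
  rewrite {1}/l eqxx mulrA; congr (_ * _); apply: eq_bigr => j ji.
  by rewrite /l (negPf ji) mul1r.
apply: psd_prod => j; rewrite /l; case: eqP => [->|_]; first exact: mult_factor_series.
by under eq_fun do under eq_fun do rewrite mul1r; exact: factor_series.
Qed.

Definition mon al z : C := \prod_j co z j ^+ al j.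
Definition mcoef al : R := \prod_j bcoef (al j).

Lemma mcoef_gt0 al : 0 < mcoef al.
Proof. by apply: prodr_gt0 => j _; exact: bcoef_gt0. Qed.

(** One term of the expansion of K is removed. The difference of the two products telescopes by a b
    - a' b' = (a - a') b + a' (b - b'), where each a - a' is a factor with one coefficient of its
    series deleted. *)
Lemma psd_mon al : psd (fun z w => K z w - rC (mcoef al) * (mon al z * (mon al w)^*)).
Proof.
pose T j z w := rC (bcoef (al j)) * (co z j ^+ al j * (co w j ^+ al j)^*).
have TE z w : rC (mcoef al) * (mon al z * (mon al w)^*) = \prod_j T j z w.
  by rewrite /T !big_split /= rC_prod rmorph_prod.
under eq_fun do under eq_fun do rewrite kernelE TE.
have dT j : series_kernel j (fun z w => factor j z w - T j z w).
  exists (fun n => if n == al j then 0 else bcoef n); split=> [n|z w].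
    by case: eqP => // _; rewrite ltW ?bcoef_gt0.
  (* The term to be deleted occurs in the partial sum only from N = al j + 1 on. *)
  apply: (@ccvg_eventually _ (fun N => bsum N (co z j * (co w j)^*) - T j z w) _ _ (al j).+1).
    move=> N aN; rewrite /bsum (bigD1 (Ordinal aN)) //= [RHS](bigD1 (Ordinal aN)) //= eqxx.
    rewrite /T rmorphXn /= -exprMn addrAC subrr add0r rC0 mul0r add0r.
    by apply: eq_bigr => n; rewrite -val_eqE /= => /negPf ->.
  by apply: ccvgD; [exact: factor_cvg | exact: ccvg_cst].
elim: (index_enum _) => [|j s IH].
  move=> s; rewrite /qform big1 ?re0 // => x _; rewrite big1 // => y _.
  by rewrite !big_nil subrr mulr0.
have -> : (fun z w => \prod_(i <- j :: s) factor i z w - \prod_(i <- j :: s) T i z w) =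
    (fun z w => (factor j z w - T j z w) * (\prod_(i <- s) factor i z w) +
      rC (bcoef (al j)) * (co z j ^+ al j * (co w j ^+ al j)^* *
        (\prod_(i <- s) factor i z w - \prod_(i <- s) T i z w))).
  apply/funext => z; apply/funext => w; rewrite !big_cons mulrA -/(T j z w).
  by rewrite mulrBl mulrBr addrA subrK.
apply: psdD; first by apply: psd_series => //; apply: psd_prod; exact: factor_series.
by apply: psdZ; [rewrite ltW ?bcoef_gt0 | apply: psd_scale].
Qed.

End BergmanKernel.

(** * Monomials in the weighted Bergman space *)

Section BergmanSpace.
Variables (R : realType) (lambda : R) (A : set (pfun R)) (ip : pfun R -> pfun R -> Cx R).
Hypothesis lambda0 : 0 < lambda.
Hypothesis bergA : weighted_bergman_space lambda A ip.
Local Notation C := (Cx R).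
Local Notation D := (polydisc R).
Local Notation K := (bergman_kernel lambda).
Local Notation bcoef := (bcoef lambda).
Local Notation bsum := (bsum lambda).
Local Notation mcoef := (mcoef lambda).
Local Notation monf al := (mon al : pfun R).
Implicit Types (z w : D) (j : 'I_3) (al be : 'I_3 -> nat) (f g : pfun R).

Lemma berg_hilbert : hilbert_space A ip. Proof. by case: bergA. Qed.
Lemma berg_sub : subspace A. Proof. by case: berg_hilbert. Qed.
Lemma berg_ip : inner_product A ip. Proof. by case: berg_hilbert. Qed.
Lemma berg_rk : is_reproducing_kernel A ip K. Proof. by case: bergA. Qed.
Local Notation hilA := berg_hilbert.
Local Notation subA := berg_sub.
Local Notation ipA := berg_ip.
Local Notation rkA := berg_rk.
Local Notation sqnorm := (nsq ip).

Lemma mult_coord j f : A f ->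
  A (fun z => co z j * f z) /\ sqnorm (fun z => co z j * f z) <= mult_bound lambda * sqnorm f.
Proof.
move=> Af; have f0 := nsq_ge0 subA ipA Af; have m0 := mult_bound_ge0 lambda0.
apply: (psd_member hilA rkA); first exact: mulr_ge0.
have -> : (fun z w => rC (mult_bound lambda * sqnorm f) * K z w - co z j * f z * (co w j * f w)^*) =
  (fun z w => rC (sqnorm f) * ((rC (mult_bound lambda) - co z j * (co w j)^*) * K z w)
   + co z j * (co w j)^* * (rC (sqnorm f) * K z w - f z * (f w)^*)).
  by apply/funext => z; apply/funext => w; rewrite rCM rmorphM /=; ring.
apply: psdD; first by apply: psdZ => //; exact: psd_mult.
apply: (psd_scale (fun z => co z j)); exact: (member_psd hilA rkA Af).
Qed.

(** Positivity yields only this upper bound; [nsq_mon] turns it into an equality once the kernel has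
    been expanded in A. *)
Lemma mon_mem al : A (monf al) /\ sqnorm (monf al) <= (mcoef al)^-1.
Proof.
have c0 := mcoef_gt0 lambda0 al.
apply: (psd_member hilA rkA); first by rewrite invr_ge0 ltW.
have -> : (fun z w => rC (mcoef al)^-1 * K z w - mon al z * (mon al w)^*) =
    (fun z w => rC (mcoef al)^-1 * (K z w - rC (mcoef al) * (mon al z * (mon al w)^*))).
  apply/funext => z; apply/funext => w; rewrite mulrBr; congr (_ - _).
  by rewrite [RHS]mulrA -rCM mulVf ?gt_eqF // rC1 mul1r.
by apply: psdZ; [rewrite invr_ge0 ltW | exact: psd_mon].
Qed.

Lemma monA al : A (monf al). Proof. by case: (mon_mem al). Qed.

Lemma rot_in (xi : 'I_3 -> C) (z : 'rV[C]_3) : (forall j, `|xi j| = 1) ->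
  in_polydisc z -> in_polydisc (\row_j (xi j * z 0 j)).
Proof.
by move=> xi1 /forallP zD; apply/forallP => j; rewrite mxE normrM xi1 mul1r.
Qed.

Definition rot (xi : 'I_3 -> C) (xi1 : forall j, `|xi j| = 1) z : D :=
  exist _ (\row_j (xi j * val z 0 j)) (rot_in xi1 (valP z)).

Lemma co_rot xi xi1 z j : co (@rot xi xi1 z) j = xi j * co z j.
Proof. by rewrite /co /= mxE. Qed.

Lemma polydiscP z w : (forall j, co z j = co w j) -> z = w.
Proof. by move=> h; apply/val_inj/rowP => j; exact: h. Qed.

Lemma kernel_rot xi xi1 z w : K (@rot xi xi1 z) (@rot xi xi1 w) = K z w.
Proof.
rewrite !kernelE; apply: eq_bigr => j _; rewrite /factor !co_rot rmorphM /=.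
have h : xi j * (xi j)^* = 1 by rewrite -normCK xi1 expr1n.
by congr (cpow (1 - _) _); rewrite mulrACA h mul1r.
Qed.

(** Weighted homogeneity of degree m, tested on rotations only. For e the indicator of one index it
    records the degree in one variable, for e = 1 the total degree. *)
Definition weight (e : 'I_3 -> nat) (m : nat) f := forall (xi : C)
  (xi1 : forall j, `|xi ^+ e j| = 1) z, f (rot xi1 z) = xi ^+ m * f z.

(** A rotation with xi^d = -1, d = |m - n|, preserves <f, g> and also changes its sign. *)
Lemma weight_orth e m n f g : m != n -> A f -> A g -> weight e m f -> weight e n g ->
  ip f g = 0.
Proof.
move=> mn Af Ag wf wg; pose d := (maxn m n - minn m n)%N.
have d0 : (0 < d)%N by rewrite /d subn_gt0; case: (ltngtP m n) mn.
pose xi : C := d.-root (-1); have xid : xi ^+ d = -1 by rewrite rootCK.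
have nxi : `|xi| = 1.
  by apply/eqP; rewrite -(pexpr_eq1 d0) // -normrX xid normrN1.
have xi1 j : `|xi ^+ e j| = 1 by rewrite normrX nxi expr1n.
have xi1' j : `|(xi ^+ e j)^*| = 1 by rewrite norm_conjC xi1.
have xx k : xi ^+ k * (xi ^+ k)^* = 1 by rewrite -normCK normrX nxi !expr1n.
have [_ h] : A (fun z => f (rot xi1 z)) /\
    ip ((fun z => f (rot xi1 z)) : pfun R) (fun z => g (rot xi1 z)) = ip f g.
  apply: (ip_kernel_map hilA rkA (psi := rot xi1')) => //; last exact: kernel_rot.
    move=> z; apply: polydiscP => j; rewrite !co_rot mulrA [_^* * _]mulrC -normCK.
    by rewrite xi1 expr1n mul1r.
  by move=> z; apply: polydiscP => j; rewrite !co_rot mulrA -normCK xi1 expr1n mul1r.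
have ef : (fun z => f (rot xi1 z)) = xi ^+ m *: f by apply/funext => z; exact: wf.
have eg : (fun z => g (rot xi1 z)) = xi ^+ n *: g by apply/funext => z; exact: wg.
move: h; rewrite ef eg (ipZl subA ipA) ?(ipZr subA ipA) //; last exact: (subZV subA).
rewrite mulrA => h.
have : xi ^+ m * (xi ^+ n)^* = -1.
  case: (ltngtP m n) mn => // mn _.
    have -> : n = (m + d)%N.
      by rewrite /d (maxn_idPr (ltnW mn)) (minn_idPl (ltnW mn)) subnKC // ltnW.
    by rewrite exprD rmorphM /= mulrA xx mul1r xid rmorphN rmorph1.
  have -> : m = (n + d)%N by rewrite /d (maxn_idPl (ltnW mn)) (minn_idPr (ltnW mn)) subnKC // ltnW.
  by rewrite exprD mulrAC xx mul1r xid.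
move=> h1; move: h; rewrite h1 mulN1r => h.
have : 2%:R * ip f g = 0 by rewrite mulr_natl mulr2n -{1}h addNr.
by move/eqP; rewrite mulf_eq0 pnatr_eq0 /= => /eqP.
Qed.

Lemma mon_weight e al : weight e (\sum_j e j * al j) (monf al).
Proof.
move=> xi xi1 z; rewrite /mon -prodrXr -big_split; apply: eq_bigr => j _ /=.
by rewrite co_rot exprMn exprM.
Qed.

Lemma mon_orth al be j : al j != be j -> ip (monf al) (monf be) = 0.
Proof.
move=> ab; pose e i : nat := i == j.
have eE ga : (\sum_i e i * ga i = ga j)%N.
  by rewrite (bigD1 j) //= /e eqxx mul1n big1 ?addn0 // => i /negPf ->.
by apply: (@weight_orth e (al j) (be j)) => //; try exact: monA;
  rewrite -[X in weight _ X]eE; exact: mon_weight.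
Qed.

(** Finite functions are what indexes the expansion of a product of three sums of length N, as used
    in [sum_box]. *)
Definition box N (h : {ffun 'I_3 -> 'I_N}) : 'I_3 -> nat := fun j => h j.

Lemma ip_box N (d : {ffun 'I_3 -> 'I_N} -> C) (h0 : {ffun 'I_3 -> 'I_N}) :
  ip (monf (box h0)) (\sum_h d h *: monf (box h)) = (d h0)^* * rC (sqnorm (monf (box h0))).
Proof.
rewrite (ip_sumr subA ipA); first last.
- exact: monA.
- by move=> h _; apply: (subZV subA); exact: monA.
rewrite (bigD1 h0) //= (ipZr subA ipA); try exact: monA.
rewrite (ipff ipA (monA _)).
rewrite big1 ?addr0 // => h hh0; rewrite (ipZr subA ipA); try exact: monA.
have [j hj] : exists j, h j != h0 j.
  apply/existsP; apply: contraT; rewrite negb_exists => /forallP H.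
  by case/eqP: hh0; apply/ffunP => j; have := H j; rewrite negbK => /eqP.
rewrite (@mon_orth _ _ j) ?mulr0 //; apply: contra_neq hj => e.
exact/val_inj.
Qed.

Definition kapprox N w : pfun R :=
  \sum_(h : {ffun 'I_3 -> 'I_N}) (rC (mcoef (box h)) * (mon (box h) w)^*) *: monf (box h).

Lemma kapproxA N w : A (kapprox N w).
Proof. by apply: (sub_sumV subA) => h _; apply: (subZV subA); exact: monA. Qed.

Lemma sum_box N w : \sum_(h : {ffun 'I_3 -> 'I_N}) rC (mcoef (box h) * sqn (mon (box h) w)) =
  \prod_j bsum N (co w j * (co w j)^*).
Proof.
rewrite /bsum bigA_distr_bigA; apply: eq_bigr => h _.
rewrite rCM -mul_conj /mon rmorph_prod -big_split /= rC_prod -big_split.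
by apply: eq_bigr => j _; rewrite /= rmorphXn exprMn.
Qed.

(** By reproduction and the upper bound on the norms of monomials, the squared distance is at most
    K(w, w) minus the partial sum s n of its expansion, and this tends to 0 by the binomial
    series. *)
Lemma kapprox_cvg w e : 0 < e -> exists N, forall n, (N <= n)%N ->
  sqnorm ((K ^~ w : pfun R) - kapprox n w) < e.
Proof.
move=> e0; have Kw : A (K ^~ w) by exact: kerA rkA w.
pose s n := \sum_(h : {ffun 'I_3 -> 'I_n}) mcoef (box h) * sqn (mon (box h) w).
have sE n : rC (s n) = \prod_j bsum n (co w j * (co w j)^*) by rewrite -sum_box rC_sum.
have [cs _] : ccvg (fun n => rC (s n)) (K w w).
  under eq_fun do rewrite sE; rewrite kernelE; apply: ccvg_prod => j.
  exact: factor_cvg.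
have dist n : sqnorm ((K ^~ w : pfun R) - kapprox n w) <= re (K w w) - s n.
  have Ak := kapproxA n w.
  rewrite (nsqB subA ipA) // {1}/nsq (reproducing rkA) // (reproducing_l hilA rkA) //.
  have -> : re (kapprox n w w)^* = s n.
    have -> : kapprox n w w = rC (s n).
      rewrite /kapprox /s rC_sum fct_sumE; apply: eq_bigr => h _.
      rewrite -[LHS]/(_ * _ * mon _ w) -mulrA [_^* * _]mulrC mul_conj.
      by rewrite rCM.
    by rewrite rC_conj.
  suff : sqnorm (kapprox n w) <= s n by lra.
  rewrite /nsq {1}/kapprox (ip_suml subA ipA) //; last first.
    by move=> h _; apply: (subZV subA); exact: monA.
  rewrite re_sum; apply: ler_sum => h _; rewrite (ipZl subA ipA) //; last exact: monA.
  rewrite ip_box rmorphM /= conjCK rC_conj.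
  have -> : rC (mcoef (box h)) * (mon (box h) w)^* *
     (rC (mcoef (box h)) * mon (box h) w * rC (sqnorm (monf (box h)))) =
     rC (mcoef (box h)) * rC (mcoef (box h)) * rC (sqnorm (monf (box h))) *
     (mon (box h) w * (mon (box h) w)^*) by ring.
  rewrite mul_conj -!rCM re_rC ler_wpM2r ?sqn_ge0 // -mulrA.
  have c0 := mcoef_gt0 lambda0 (box h).
  rewrite -[X in _ <= X]mulr1 ler_wpM2l ?(ltW c0) // mulrC -ler_pdivlMr // div1r.
  by case: (mon_mem (box h)).
have : \forall n \near \oo, re (K w w) - e < s n.
  by apply: (cvgr_gt _ cs); rewrite ltrBlDr ltrDl.
case=> N _ NP; exists N => n nN; apply: le_lt_trans (dist n) _.
by have := NP n nN; rewrite /=; lra.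
Qed.

(** A point at which no monomial vanishes. *)
Lemma half_in : in_polydisc (\row_(j < 3) (rC 2^-1 : C)).
Proof. by apply/forallP => j; rewrite mxE norm_lt1 sqn_rC; lra. Qed.

(** Pairing z^alpha with K(., w) - [kapprox n w] gives (1 - a_alpha |z^alpha|^2) w^alpha. This tends
    to 0, although it does not depend on n once alpha lies in the box. *)
Lemma nsq_mon al : sqnorm (monf al) = (mcoef al)^-1.
Proof.
have c0 := mcoef_gt0 lambda0 al; have m0 := nsq_ge0 subA ipA (monA al).
pose w : D := exist (fun z : 'rV[C]_3 => is_true (in_polydisc z)) _ half_in.
pose q := sqn (mon al w); have q0 : 0 < q.
  rewrite lt_neqAle sqn_ge0 andbT eq_sym; apply/negP => /eqP q0.
  have : mon al w = 0 by apply: sqn_eq0; rewrite -/q q0.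
  move/eqP; rewrite prodf_seq_eq0 => /hasP[j _]; rewrite /= expf_eq0 /co /= mxE.
  by move=> /andP[_ /eqP /rC_inj]; lra.
pose x := 1 - mcoef al * sqnorm (monf al).
suff x0 : x ^+ 2 * q <= 0.
  have : x = 0.
    move: x0 q0; move: (x) (q) => *; apply/eqP.
    by rewrite -sqrf_eq0 eq_le sqr_ge0 andbT; nra.
  by rewrite /x => x00; apply: (mulfI (lt0r_neq0 c0)); rewrite mulfV ?gt_eqF //; lra.
apply/ler_addgt0Pr => e e0; rewrite add0r.
have [|N NP] := @kapprox_cvg w (e / (sqnorm (monf al) + 1)); first by rewrite divr_gt0 // ltr_wpDl.
(* The indices of a box are strictly below n, hence the successor. *)
pose n := maxn N (\max_j al j).+1; have {}NP := NP n (leq_maxl _ _).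
have aln j : (al j < n)%N.
  by apply: leq_trans (leq_maxr _ _); rewrite ltnS; apply: leq_bigmax.
pose h0 : {ffun 'I_3 -> 'I_n} := [ffun j => Ordinal (aln j)].
have h0E : box h0 = al by apply/funext => j; rewrite /box ffunE.
have Kw : A (K ^~ w) by exact: kerA rkA w.
have Ak := kapproxA n w.
have := cauchy_schwarz subA ipA (monA al) (subBV subA Kw Ak).
rewrite (ipBr subA ipA) //; last exact: monA.
rewrite (reproducing rkA); last exact: monA.
have -> : ip (monf al) (kapprox n w) = rC (mcoef al) * mon al w * rC (sqnorm (monf al)).
  by rewrite -{1}h0E ip_box h0E rmorphM /= conjCK rC_conj.
have -> : mon al w - rC (mcoef al) * mon al w * rC (sqnorm (monf al)) = rC x * mon al w.
  by rewrite /x rCD rC1 rCN rCM; ring.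
rewrite sqnM sqn_rC -/q => /le_trans; apply.
apply: ltW; move: NP; rewrite ltr_pdivlMr; last by rewrite ltr_wpDl.
by have := nsq_ge0 subA ipA (subBV subA Kw Ak); nra.
Qed.

(** Such an f satisfies f w = <f, K(., w) - [kapprox N w]>, which is arbitrarily small. *)
Lemma mon_total f : A f -> (forall al, ip f (monf al) = 0) -> f = 0.
Proof.
move=> Af fo; apply/funext => w; apply: sqn_eq0; apply/ler_addgt0Pr => e e0.
rewrite add0r; have f0 := nsq_ge0 subA ipA Af.
have [|N NP] := @kapprox_cvg w (e / (sqnorm f + 1)); first by rewrite divr_gt0 // ltr_wpDl.
have {}NP := NP N (leqnn _).
have Kw : A (K ^~ w) by exact: kerA rkA w.
have Ak := kapproxA N w.
have := cauchy_schwarz subA ipA Af (subBV subA Kw Ak).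
rewrite (ipBr subA ipA) // (reproducing rkA) //.
have -> : ip f (kapprox N w) = 0.
  rewrite (ip_sumr subA ipA) //; last by move=> h _; apply: (subZV subA); exact: monA.
  by rewrite big1 // => h _; rewrite (ipZr subA ipA) ?fo ?mulr0 //; exact: monA.
rewrite subr0 => /le_trans; apply.
apply: ltW; move: NP; rewrite ltr_pdivlMr; last by rewrite ltr_wpDl.
by have := nsq_ge0 subA ipA (subBV subA Kw Ak); nra.
Qed.

End BergmanSpace.

(** * The action of the symmetric group *)

Section SymmetricGroup3.
Implicit Types (s t : 'S_3).

Definition S3_list : seq 'S_3 := [:: 1; tperm 0%R 1%R; tperm 0%R ord_max;
  tperm 1%R ord_max; tperm 0%R 1%R * tperm 1%R ord_max;
  tperm 1%R ord_max * tperm 0%R 1%R]%g.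

Lemma S3_list_uniq : uniq S3_list.
Proof.
apply: (@map_uniq _ _ (fun s : 'S_3 => (s 0%R, s 1%R))).
by rewrite /= !permM !permE.
Qed.

Lemma S3_perm_enum : perm_eq S3_list (enum {: 'S_3}).
Proof.
apply: uniq_perm; rewrite ?enum_uniq ?S3_list_uniq //.
have sub : {subset S3_list <= enum {: 'S_3}} by move=> s _; rewrite mem_enum.
have le : (size (enum {: 'S_3}) <= size S3_list)%N by rewrite -cardE card_Sn.
by case: (uniq_min_size S3_list_uniq sub le).
Qed.

Lemma sum_S3 (V : nmodType) (F : 'S_3 -> V) : \sum_s F s =
  F 1%g + F (tperm 0 1) + F (tperm 0 ord_max) + F (tperm 1 ord_max) +
  F (tperm 0%R 1%R * tperm 1%R ord_max)%g + F (tperm 1%R ord_max * tperm 0%R 1%R)%g.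
Proof.
rewrite -big_enum -(perm_big _ S3_perm_enum) /= !big_cons big_nil addr0.
by rewrite !addrA.
Qed.

End SymmetricGroup3.

Section Action.
Variable R : realType.
Local Notation C := (Cx R).
Local Notation D := (polydisc R).
Implicit Types (z w : D) (f g : pfun R) (s t : 'S_3) (b : bool).

Lemma co_pact s z j : co (pact s z) j = co z (s^-1%g j).
Proof. by rewrite /co /= mxE. Qed.

(** The product [(t * s)%g] applies t first, so this is the usual left action. *)
Lemma pactM s t z : pact s (pact t z) = pact (t * s)%g z.
Proof. by apply: polydiscP => j; rewrite !co_pact invMg permM. Qed.

Lemma pact1 z : pact 1%g z = z.
Proof. by apply: polydiscP => j; rewrite co_pact invg1 perm1. Qed.

Lemma kernel_pact lambda s z w :
  bergman_kernel lambda (pact s z) (pact s w) = bergman_kernel lambda z w.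
Proof.
rewrite !kernelE [RHS](reindex_inj (@perm_inj _ s^-1%g)).
by apply: eq_bigr => j _; rewrite /factor !co_pact.
Qed.

Definition act s f : pfun R := fun z => f (pact s^-1%g z).

Lemma actM s t f : act s (act t f) = act (t * s)%g f.
Proof. by apply/funext => z; rewrite /act pactM invMg. Qed.

Lemma act1 f : act 1%g f = f.
Proof. by apply/funext => z; rewrite /act invg1 pact1. Qed.

Definition chi1 b s : C := if b then (-1) ^+ s else 1.

Arguments chi1 : simpl never.

Lemma chi1M b s t : chi1 b (s * t)%g = chi1 b s * chi1 b t.
Proof. by rewrite /chi1; case: b; rewrite ?mulr1 // odd_permM signr_addb. Qed.
Lemma chi1V b s : chi1 b s^-1%g = chi1 b s.
Proof. by rewrite /chi1 odd_permV. Qed.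
Lemma chi1_sqr b s : chi1 b s * chi1 b s = 1.
Proof. by rewrite /chi1; case: b; rewrite ?mulr1 // -expr2 sqrr_sign. Qed.
Lemma chi1_conj b s : (chi1 b s)^* = chi1 b s.
Proof. by rewrite /chi1; case: b; rewrite ?rmorph1 // rmorphXn rmorphN rmorph1. Qed.

Lemma sum_sign : \sum_s chi1 true s = 0 :> C.
Proof.
have h : \sum_s chi1 true s = - \sum_s chi1 true s.
  transitivity (\sum_s chi1 true (tperm 0%R 1%R * s)%g).
    exact: reindex_inj (mulgI _).
  by rewrite -sumrN; apply: eq_bigr => s _; rewrite chi1M /chi1 odd_tperm expr1 mulN1r.
have : 2%:R * \sum_s chi1 true s = 0 by rewrite mulr_natl mulr2n {1}h addNr.
by move/eqP; rewrite mulf_eq0 pnatr_eq0 /= => /eqP.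
Qed.

Lemma character21 s : 2%:R * character R Part21 s = 6%:R * (s == 1%g)%:R - 1 - (-1) ^+ s.
Proof.
have -> : character R Part21 s = ((s 0 == 0%N :> nat)%:R - (s ord_max == 0%N :> nat)%:R)
   + ((s 1 == 1%N :> nat)%:R - (s ord_max == 1%N :> nat)%:R).
  have h (i : 'I_2) : (irrep R Part21 s) i i =
      ((delta_mx 0 i : 'rV[C]_2) *m irrep_mx R Part21 s) 0 i.
    have e := congr1 (fun M : 'rV[C]_2 => M 0 i) (rowE i (irrep_mx R Part21 s)).
    by apply: (etrans _ e); rewrite [RHS]mxE.
  rewrite /character /mxtrace !big_ord_recl big_ord0 addr0 !h !std_mxE !mxE /=.
  by rewrite !mul1r !mul0r addr0 add0r.
have : s \in S3_list by rewrite (perm_mem S3_perm_enum) mem_enum.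
have e1 (t : 'S_3) (i j : 'I_3) : t i = j -> i != j -> (t == 1%g) = false.
  by move=> ti ij; apply/eqP => t1; case/eqP: ij; rewrite -ti t1 perm1.
rewrite !inE => /orP[|/orP[|/orP[|/orP[|/orP[]]]]] /eqP->.
- by rewrite !perm1 odd_perm1 (eqxx (1%g : 'S_3)) /=; ring.
- by rewrite (e1 _ 0 1) ?tpermL // odd_tperm !permE /=; ring.
- by rewrite (e1 _ 0 ord_max) ?tpermL // odd_tperm !permE /=; ring.
- by rewrite (e1 _ 1 ord_max) ?tpermL // odd_tperm !permE /=; ring.
- by rewrite (e1 _ 0 ord_max) ?permM ?permE //= odd_permM !odd_tperm ?permM ?permE /=; ring.
- by rewrite (e1 _ 0 1) ?permM ?permE //= odd_permM !odd_tperm ?permM ?permE /=; ring.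
Qed.

Definition avg b f : pfun R := (6%:R^-1 : C) *: \sum_s chi1 b s *: act s f.

(** The weight (2/6) chi of type (2,1) is [s = 1] - 1/6 - sgn(s)/6, so this projection is the
    complement of the two averages and inherits their properties. *)
Lemma isotypic_projE (p : partition3) f : isotypic_proj p f =
  match p with
  | Part3 => avg false f
  | Part21 => f - avg false f - avg true f
  | Part111 => avg true f
  end.
Proof.
have f6 : (3`!)%:R = 6%:R :> C by [].
case: p; rewrite /isotypic_proj f6.
- have e s : character R Part3 s = 1 by rewrite /character /= mxtrace1.
  rewrite e div1r /avg; congr (_ *: _); apply: eq_bigr => s _.
  by rewrite e rmorph1.
- have e s : character R Part21 s = 3%:R * (s == 1%g)%:R - 2^-1 - 2^-1 * chi1 true s.
    apply: (mulfI (_ : 2%:R != 0)); first by rewrite pnatr_eq0.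
    rewrite character21.
    rewrite -[(-1) ^+ s]/(chi1 true s).
    move: (chi1 true s) => x.
    move: ((s == 1%g)%:R) => y.
    by field.
  have e1 : character R Part21 1%g = 2%:R.
    by rewrite e (eqxx (1%g : 'S_3)) /chi1 odd_perm1 expr0 /=; field.
  rewrite e1; pose x s : C := 3%:R * (s == 1%g)%:R - 2^-1 - 2^-1 * chi1 true s.
  have -> : f - avg false f - avg true f =
      \sum_s ((s == 1%g)%:R *: act s f - 6%:R^-1 *: (chi1 false s *: act s f)
        - 6%:R^-1 *: (chi1 true s *: act s f)).
    rewrite !sumrB -!scaler_sumr ; congr (_ - _ - _); last by rewrite scaler_sumr.
    rewrite (bigD1 1%g) //= eqxx scale1r act1 big1 ?addr0 // => s /negPf ->.
    by rewrite scale0r.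
  rewrite scaler_sumr; apply: eq_bigr => s _; rewrite !scalerA -!scalerBl.
  congr (_ *: _).
  have e2 : (2%:R^-1 : C)^* = 2%:R^-1 by rewrite fmorphV rmorph_nat.
  have e3 (n : nat) : (n%:R : C)^* = n%:R by rewrite rmorph_nat.
  rewrite e !raddfB /= !rmorphM /= chi1_conj e2 !e3.
  rewrite -[chi1 false s]/(1 : C); move: (chi1 true s) ((s == 1%g)%:R) => y y'.
  by field.
- have e s : character R Part111 s = chi1 true s by rewrite /character /= mxtrace_scalar.
  rewrite e {1}/chi1 odd_perm1 expr0 div1r /avg; congr (_ *: _); apply: eq_bigr => s _.
  by rewrite e chi1_conj.
Qed.

Lemma act_lin s a f g : act s (a *: f + g) = a *: act s f + act s g.
Proof. by []. Qed.

Lemma avg_lin b a f g : avg b (a *: f + g) = a *: avg b f + avg b g.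
Proof.
rewrite /avg scalerA [a * _]mulrC -scalerA -scalerDr; congr (_ *: _).
rewrite scaler_sumr -big_split; apply: eq_bigr => s _ /=.
by rewrite act_lin scalerDr !scalerA mulrC.
Qed.

Lemma avgD b f g : avg b (f + g) = avg b f + avg b g.
Proof. by rewrite -{1}[f]scale1r avg_lin scale1r. Qed.
Lemma avg0 b : avg b 0 = 0.
Proof. by apply: (addrI (avg b 0)); rewrite -avgD !addr0. Qed.
Lemma avgZ b a f : avg b (a *: f) = a *: avg b f.
Proof. by rewrite -[a *: f]addr0 avg_lin avg0 addr0. Qed.
Lemma avgB b f g : avg b (f - g) = avg b f - avg b g.
Proof. by rewrite avgD -scaleN1r avgZ scaleN1r. Qed.

Lemma act_avg b t f : act t (avg b f) = chi1 b t *: avg b f.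
Proof.
have -> : act t (avg b f) = 6%:R^-1 *: \sum_s chi1 b s *: act (s * t)%g f.
  apply/funext => z;
  rewrite -[LHS]/((6%:R^-1 *: \sum_s chi1 b s *: act s f : pfun R) (pact t^-1%g z)).
  congr (_ * _); rewrite !fct_sumE; apply: eq_bigr => s _.
  by rewrite -actM.
rewrite /avg scalerA [chi1 b t * _]mulrC -scalerA scaler_sumr; congr (_ *: _).
rewrite [RHS](reindex_inj (mulIg t)) /=; apply: eq_bigr => s _.
by rewrite scalerA chi1M mulrC -mulrA chi1_sqr mulr1.
Qed.

Lemma avg_idem b f : avg b (avg b f) = avg b f.
Proof.
rewrite {1}/avg; under eq_bigr do rewrite act_avg scalerA chi1_sqr scale1r.
rewrite sumr_const card_Sn -[X in _ *: X]scaler_nat scalerA mulVf ?scale1r // pnatr_eq0.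
Qed.

Lemma avg_avg b f : avg b (avg (~~ b) f) = 0.
Proof.
rewrite {1}/avg; under eq_bigr do rewrite act_avg scalerA.
rewrite -scaler_suml (_ : \sum_s _ = 0) ?scale0r ?scaler0 // -[RHS]sum_sign.
by apply: eq_bigr => s _; rewrite /chi1; case: b => /=; rewrite ?mulr1 ?mul1r.
Qed.

Lemma meval_msym (s : 'S_3) (v : 'I_3 -> C) (q : mpoly.mpoly 3 C) :
  mpoly.meval v (mpoly.msym s q) = mpoly.meval (fun i => v (s i)) q.
Proof.
rewrite [in LHS](mpoly.mpolyE q) (raddf_sum (mpoly.msym s)) (raddf_sum (mpoly.meval v)).
rewrite mpoly.mevalE; apply: eq_bigr => m _ /=.
rewrite mpoly.msymZ mpoly.msymX mpoly.mevalZ mpoly.mevalX; congr (_ * _).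
rewrite (reindex_inj (@perm_inj _ s)); apply: eq_bigr => i _.
by rewrite mpoly.mnmE permK.
Qed.

Definition ev (q : mpoly.mpoly 3 C) : pfun R := fun z => mpoly.meval (co z) q.

Lemma pmulE q f z : pmul q f z = ev q z * f z.
Proof. by []. Qed.

Lemma ev_act s q : act s (ev q) = ev (mpoly.msym s q).
Proof.
apply/funext => z; rewrite /ev meval_msym /act; apply: mpoly.meval_eq => j.
by rewrite co_pact invgK.
Qed.

Lemma ev_sym q s z : q \is @mpoly.symmetric 3 C -> ev q (pact s z) = ev q z.
Proof.
move=> /mpoly.issymP sq; have := congr1 (fun g : pfun R => g z) (ev_act s^-1%g q).
by rewrite /act invgK sq.
Qed.

Lemma avg_pmul b q f : q \is @mpoly.symmetric 3 C -> avg b (pmul q f) = pmul q (avg b f).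
Proof.
move=> sq; apply/funext => z; rewrite pmulE.
rewrite -[RHS]/(ev q z * (6%:R^-1 * (\sum_s chi1 b s *: act s f : pfun R) z)).
rewrite mulrCA; congr (_ * _); rewrite !fct_sumE mulr_sumr; apply: eq_bigr => s _.
rewrite -[LHS]/(chi1 b s * (ev q (pact s^-1%g z) * f (pact s^-1%g z))) ev_sym //.
by rewrite mulrCA.
Qed.

End Action.

(** * The projections and their ranges as Hilbert modules *)

Section Modules.
Variables (R : realType) (lambda : R) (A : set (pfun R)) (ip : pfun R -> pfun R -> Cx R).
Hypothesis lambda0 : 0 < lambda.
Hypothesis bergA : weighted_bergman_space lambda A ip.
Local Notation C := (Cx R).
Local Notation D := (polydisc R).
Local Notation sqnorm := (nsq ip).
Local Notation hilA := (berg_hilbert bergA).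
Local Notation subA := (berg_sub bergA).
Local Notation ipA := (berg_ip bergA).
Local Notation rkA := (berg_rk bergA).
Local Notation sympoly q := (q \is @mpoly.symmetric 3 C).
Implicit Types (z w : D) (j : 'I_3) (f g h : pfun R) (s : 'S_3) (b : bool)
  (p : partition3) (q : mpoly.mpoly 3 C).

Lemma act_isometry s f g : A f -> A g -> A (act s f) /\ ip (act s f) (act s g) = ip f g.
Proof.
apply: (ip_kernel_map hilA rkA (psi := pact s)) => [z|z|z w].
- by rewrite pactM mulVg pact1.
- by rewrite pactM mulgV pact1.
- exact: kernel_pact.
Qed.

Lemma actA s f : A f -> A (act s f).
Proof. by move=> Af; case: (act_isometry s Af Af). Qed.

Lemma ip_act s f g : A f -> A g -> ip (act s f) g = ip f (act s^-1%g g).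
Proof.
move=> Af Ag; have [_ <-] := act_isometry s Af (actA s^-1%g Ag).
by rewrite actM mulVg act1.
Qed.

Lemma avgA b f : A f -> A (avg b f).
Proof.
move=> Af; apply: (subZV subA); apply: (sub_sumV subA) => s _.
by apply: (subZV subA); exact: actA.
Qed.

Lemma ip_avg b f g : A f -> A g -> ip (avg b f) g = ip f (avg b g).
Proof.
move=> Af Ag; have As (h : pfun R) s : A h -> A (chi1 R b s *: act s h).
  by move=> Ah; apply: (subZV subA); exact: actA.
have AS (h : pfun R) : A h -> A (\sum_s chi1 R b s *: act s h).
  by move=> Ah; apply: (sub_sumV subA) => s _; exact: As.
rewrite /avg (ipZl subA ipA) ?(ipZr subA ipA) //; try exact: AS.
rewrite fmorphV rmorph_nat; congr (_ * _).
rewrite (ip_suml subA ipA) ?(ip_sumr subA ipA) //; try by move=> s _; exact: As.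
rewrite (reindex_inj invg_inj); apply: eq_bigr => s _.
rewrite (ipZl subA ipA) ?(ipZr subA ipA) //; try exact: actA.
by rewrite ip_act // invgK chi1V chi1_conj.
Qed.

Lemma projA p f : A f -> A (isotypic_proj p f).
Proof.
move=> Af; rewrite isotypic_projE; case: p; try exact: avgA.
by apply: (subBV subA); [apply: (subBV subA) => // |]; exact: avgA.
Qed.

Lemma proj_lin p (a : C) f g :
  isotypic_proj p (a *: f + g) = a *: isotypic_proj p f + isotypic_proj p g.
Proof.
rewrite !isotypic_projE; case: p; rewrite !avg_lin // !opprD !scalerBr.
by rewrite [X in X + _ = _]addrACA [LHS]addrACA.
Qed.

Lemma projB p f g : isotypic_proj p (f - g) = isotypic_proj p f - isotypic_proj p g.
Proof. by rewrite addrC -scaleN1r proj_lin scaleN1r addrC. Qed.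

Lemma projD p f g : isotypic_proj p (f + g) = isotypic_proj p f + isotypic_proj p g.
Proof. by rewrite -{1}[f]scale1r proj_lin scale1r. Qed.

Lemma ip_proj p f g : A f -> A g -> ip (isotypic_proj p f) g = ip f (isotypic_proj p g).
Proof.
move=> Af Ag; rewrite !isotypic_projE; case: p; try exact: ip_avg.
have := avgA false Af; have := avgA true Af; have := avgA false Ag; have := avgA true Ag.
move=> A1 A2 A3 A4; have A5 := subBV subA Af A4; have A6 := subBV subA Ag A2.
by rewrite !(ipBl subA ipA) // !(ipBr subA ipA) // !ip_avg.
Qed.

Lemma proj_orth p p' f : p <> p' -> isotypic_proj p (isotypic_proj p' f) = 0.
Proof.
rewrite isotypic_projE [isotypic_proj _ _]isotypic_projE.
have h1 (g : pfun R) : avg false (avg true g) = 0 := avg_avg false g.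
have h2 (g : pfun R) : avg true (avg false g) = 0 := avg_avg true g.
(* What remains is algebra with two additive idempotents a and b such that a b = b a = 0. *)
move: h1 h2 (@avg_idem R false) (@avg_idem R true) (@avgB R false) (@avgB R true).
move: (@avg R false) (@avg R true) => a b h1 h2 e1 e2 aB bB.
case: p p' => [] [] // _.
- by rewrite !aB e1 h1 subrr subr0.
- by rewrite e1 h2 subrr subr0.
- by rewrite h1 e2 subr0 subrr.
- by rewrite !bB h2 e2 subr0 subrr.
Qed.

Lemma proj_sum f : f = isotypic_proj Part3 f + isotypic_proj Part21 f + isotypic_proj Part111 f.
Proof. by rewrite !isotypic_projE -addrA subrK addrC subrK. Qed.

Lemma proj_idem p f : isotypic_proj p (isotypic_proj p f) = isotypic_proj p f.
Proof.
rewrite [in RHS](proj_sum f) !projD.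
case: p.
- by rewrite (@proj_orth Part3 Part21) // (@proj_orth Part3 Part111) // !addr0.
- by rewrite (@proj_orth Part21 Part3) // (@proj_orth Part21 Part111) // add0r addr0.
- by rewrite (@proj_orth Part111 Part3) // (@proj_orth Part111 Part21) // !add0r.
Qed.

Lemma proj_pmul p q f : sympoly q -> isotypic_proj p (pmul q f) = pmul q (isotypic_proj p f).
Proof.
move=> sq; rewrite !isotypic_projE; case: p; rewrite !avg_pmul //.
by apply/funext => z; rewrite -[LHS]/(pmul q f z - pmul q (avg false f) z - pmul q (avg true f) z)
  !pmulE -!mulrBr.
Qed.

Definition bounded_mult (c : D -> C) := (forall f, A f -> A (fun z => c z * f z)) /\
  exists2 M : R, 0 <= M & forall f, A f -> sqnorm (fun z => c z * f z) <= M * sqnorm f.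

Lemma bounded_mult_cst (a : C) : bounded_mult (fun=> a).
Proof.
split=> [f Af|]; first exact: (subZV subA).
exists (sqn a); first exact: sqn_ge0.
by move=> f Af; rewrite -(nsqZ subA ipA).
Qed.

Lemma bounded_multD c d : bounded_mult c -> bounded_mult d -> bounded_mult (fun z => c z + d z).
Proof.
move=> [cA [M M0 cM]] [dA [N N0 dN]].
have e (f : pfun R) : (fun z => (c z + d z) * f z) =
    ((fun z => c z * f z) : pfun R) + ((fun z => d z * f z) : pfun R).
  by apply/funext => z; rewrite mulrDl.
split=> [f Af|]; first by rewrite e; apply: (subDV subA); [exact: cA | exact: dA].
exists (2 * (M + N)) => [|f Af]; first by lra.
rewrite e; apply: le_trans (nsqD_le subA ipA (cA f Af) (dA f Af)) _.
by have := cM f Af; have := dN f Af; lra.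
Qed.

Lemma bounded_multM c d : bounded_mult c -> bounded_mult d -> bounded_mult (fun z => c z * d z).
Proof.
move=> [cA [M M0 cM]] [dA [N N0 dN]].
have e (f : pfun R) : (fun z => (c z * d z) * f z) = (fun z => c z * (d z * f z)).
  by apply/funext => z; rewrite mulrA.
split=> [f Af|]; first by rewrite e; apply: cA; exact: dA.
exists (M * N) => [|f Af]; first exact: mulr_ge0.
rewrite e; apply: le_trans (cM _ (dA f Af)) _.
by rewrite -mulrA ler_wpM2l // dN.
Qed.

Lemma bounded_mult_ev q : bounded_mult (ev q).
Proof.
rewrite /ev; under eq_fun do rewrite mpoly.mevalE.
elim: (mpoly.msupp q) => [|m s IH].
  by under eq_fun do rewrite big_nil; exact: bounded_mult_cst.
under eq_fun do rewrite big_cons; apply: bounded_multD => //.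
apply: bounded_multM; first exact: bounded_mult_cst.
elim: (index_enum _) => [|j r IHr].
  by under eq_fun do rewrite big_nil; exact: bounded_mult_cst.
under eq_fun do rewrite big_cons; apply: bounded_multM => //.
have bj : bounded_mult (fun z => co z j).
  split=> [f Af|]; first by case: (mult_coord lambda0 bergA j Af).
  exists (mult_bound lambda) => [|f Af]; first exact: mult_bound_ge0.
  by case: (mult_coord lambda0 bergA j Af).
elim: (m j) => [|n IHn]; first by under eq_fun do rewrite expr0; exact: bounded_mult_cst.
by under eq_fun do rewrite exprS; exact: bounded_multM.
Qed.

Lemma pmulA q f : A f -> A (pmul q f).
Proof. by move=> Af; case: (bounded_mult_ev q) => + _; apply. Qed.

Lemma pmul_bounded q : exists c : R, forall f, A f -> hnorm ip (pmul q f) <= c * hnorm ip f.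
Proof.
case: (bounded_mult_ev q) => _ [M M0 hM]; exists (Num.sqrt M) => f Af.
by apply: (hnorm_le (ip := ip) (G := pmul q)) => //; exact: hM.
Qed.

Lemma hilbert_module_A : hilbert_module A ip.
Proof.
by split=> [|q _]; [exact: hilA | split; [exact: pmulA | exact: pmul_bounded]].
Qed.

Lemma proj_imageP p f : (isotypic_proj p @` A) f <-> A f /\ isotypic_proj p f = f.
Proof.
split=> [[g Ag <-]|[Af e]]; last by exists f.
by split; [exact: projA | exact: proj_idem].
Qed.

Lemma proj_contract p f : A f -> sqnorm (isotypic_proj p f) <= sqnorm f.
Proof.
move=> Af; have Pf := projA p Af; have Bf := subBV subA Af Pf.
have {2}-> : f = isotypic_proj p f + (f - isotypic_proj p f) by rewrite addrC subrK.
rewrite (nsqD subA ipA) // ip_proj // projB proj_idem subrr (ip0r subA ipA) //.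
by rewrite re0 mulr0 addr0 lerDl; exact: (nsq_ge0 subA ipA).
Qed.

Lemma hilbert_module_proj p : hilbert_module (isotypic_proj p @` A) ip.
Proof.
split; last first.
  move=> q sq; have [M hM] := pmul_bounded q; split=> [f|].
    move=> /proj_imageP[Af e]; apply/proj_imageP; split; first exact: pmulA.
    by rewrite proj_pmul // e.
  by exists M => f /proj_imageP[Af _]; exact: hM.
split.
- split; first by exists 0; [exact: (sub0V subA) | rewrite -{1}(subrr 0) projB subrr].
  move=> a f g /proj_imageP[Af ef] /proj_imageP[Ag eg]; apply/proj_imageP.
  by rewrite proj_lin ef eg; split=> //; exact: (subPV subA).
- have [h1 h2 h3] := ipA.
  by split=> [a f g h /proj_imageP[? _] /proj_imageP[? _] /proj_imageP[? _]|
    f g /proj_imageP[? _] /proj_imageP[? _]|f /proj_imageP[? _]]; auto.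
- apply/completeP => u Vu cu.
  have Au n : A (u n) by have /proj_imageP[] := Vu n.
  have Pu n : isotypic_proj p (u n) = u n by have /proj_imageP[] := Vu n.
  have [_ _ /completeP cA] := hilA; have [f Af fu] := cA u Au cu.
  exists f => //; apply/proj_imageP; split=> //.
  have Pf := projA p Af.
  (* The range is closed: the projection fixes [u N] and is a contraction, so it moves f by at most
     twice the distance from f to [u N]. *)
  apply/eqP; rewrite -subr_eq0; apply/eqP; apply: (nsq_le0 ipA); first exact: (subBV subA).
  apply/ler_addgt0Pr => e e0; rewrite add0r.
  have [|N /(_ N (leqnn _)) h] := fu (e / 4); first by rewrite divr_gt0.
  have Af1 := subBV subA (Au N) Af; have Af2 := projA p Af1.
  have -> : isotypic_proj p f - f = - isotypic_proj p (u N - f) + (u N - f).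
    by rewrite projB Pu opprB addrA subrK.
  apply: le_trans (nsqD_le subA ipA (subNV subA Af2) Af1) _.
  by rewrite (nsqN subA ipA) //; have := proj_contract p Af1; lra.
Qed.

Lemma orthogonal_sum_proj : orthogonal_sum ip A (fun p => isotypic_proj p @` A).
Proof.
split=> [p p' f g pp' /proj_imageP[Af <-] /proj_imageP[Ag <-]|].
  have Pg := projA p' Ag.
  by rewrite ip_proj // proj_orth // (ip0r subA ipA).
apply/seteqP; split=> [f Af|f [f1 [f2 [f3 [[g1 A1 <-] [g2 A2 <-] [g3 A3 <-] ->]]]]].
  exists (isotypic_proj Part3 f), (isotypic_proj Part21 f), (isotypic_proj Part111 f).
  by split; [exists f | exists f | exists f | exact: proj_sum].
by apply: (subDV subA); [apply: (subDV subA)|]; exact: projA.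
Qed.

End Modules.

(** * Symmetric polynomials and alternants *)

Section SymmetricFunctions.
Variable R : realType.
Local Notation C := (Cx R).
Local Notation D := (polydisc R).
Local Notation sympoly q := (q \is @mpoly.symmetric 3 C).
Implicit Types (z w : D) (f g h : pfun R) (b : bool).

Definition symmetric_fun (c : D -> C) := exists2 q, sympoly q & c = ev q.

Lemma symmetric_cst (a : C) : symmetric_fun (fun=> a).
Proof.
exists (mpoly.mpolyC 3 a).
  by rewrite -[X in X \is _]mulr1 mpoly.mul_mpolyC; apply: rpredZ; exact: rpred1.
by apply/funext => z; rewrite /ev mpoly.mevalC.
Qed.

Lemma symmetricD c d : symmetric_fun c -> symmetric_fun d -> symmetric_fun (fun z => c z + d z).
Proof.
move=> [q sq ->] [q' sq' ->]; exists (q + q'); first exact: rpredD.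
by apply/funext => z; rewrite /ev mpoly.mevalD.
Qed.

Lemma symmetricM c d : symmetric_fun c -> symmetric_fun d -> symmetric_fun (fun z => c z * d z).
Proof.
move=> [q sq ->] [q' sq' ->]; exists (q * q'); first exact: rpredM.
by apply/funext => z; rewrite /ev mpoly.mevalM.
Qed.

Definition psum n z : C := co z 0 ^+ n + co z 1 ^+ n + co z ord_max ^+ n.

Lemma sum_I3 (V : nmodType) (F : 'I_3 -> V) : \sum_i F i = F 0 + F 1 + F ord_max.
Proof.
rewrite !big_ord_recl big_ord0 addr0 addrA; congr (_ + F _ + F _); exact/val_inj.
Qed.

Lemma prod_I3 (F : 'I_3 -> C) : \prod_i F i = F 0 * F 1 * F ord_max.
Proof.
rewrite !big_ord_recl big_ord0 mulr1 mulrA; congr (_ * F _ * F _); exact/val_inj.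
Qed.

Lemma symmetric_psum n : symmetric_fun (psum n).
Proof.
pose X i : mpoly.mpoly 3 C := mpoly.mpolyX C (mpoly.mnm1 i).
exists (\sum_i X i ^+ n); last first.
  apply/funext => z; rewrite /ev raddf_sum sum_I3 /=.
  by rewrite !rmorphXn /= !mpoly.mevalXU.
apply/mpoly.issymP => s; rewrite raddf_sum [RHS](reindex_inj (@perm_inj _ s)).
apply: eq_bigr => i _; rewrite /= rmorphXn /=; congr (_ ^+ _).
by rewrite /mpoly.msym /X mpoly.mmapX mpoly.mmap1U.
Qed.

(** The elementary symmetric functions, obtained by Newton's identities from power sums, whose
    symmetry is immediate. *)
Definition esym1 z : C := psum 1 z.
Definition esym2 z : C := 2%:R^-1 * (psum 1 z * psum 1 z + (-1) * psum 2 z).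
Definition esym3 z : C := 6%:R^-1 * (psum 1 z * (psum 1 z * psum 1 z) +
  ((- 3%:R) * (psum 1 z * psum 2 z) + 2%:R * psum 3 z)).

Lemma symmetric_esym1 : symmetric_fun esym1. Proof. exact: symmetric_psum. Qed.
Lemma symmetric_esym2 : symmetric_fun esym2.
Proof.
apply: symmetricM; first exact: symmetric_cst.
apply: symmetricD; apply: symmetricM; try exact: symmetric_psum; exact: symmetric_cst.
Qed.
Lemma symmetric_esym3 : symmetric_fun esym3.
Proof.
have p (n : nat) : symmetric_fun (psum n) by exact: symmetric_psum.
exact: symmetricM (symmetric_cst _) (symmetricD (symmetricM (p 1%N) (symmetricM (p 1%N) (p 1%N)))
  (symmetricD (symmetricM (symmetric_cst _) (symmetricM (p 1%N) (p 2%N)))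
    (symmetricM (symmetric_cst _) (p 3%N)))).
Qed.

Definition mon3 (a b c : nat) : pfun R :=
  fun z => co z 0 ^+ a * co z 1 ^+ b * co z ord_max ^+ c.

Definition exp3 (a b c : nat) (j : 'I_3) : nat := nth 0%N [:: a; b; c] j.

Lemma mon_exp3 (a b c : nat) : (mon (exp3 a b c) : pfun R) = mon3 a b c.
Proof. by apply/funext => z; rewrite /mon prod_I3. Qed.

Lemma mon_mon3 al : (mon al : pfun R) = mon3 (al 0) (al 1) (al ord_max).
Proof. by apply/funext => z; rewrite /mon prod_I3. Qed.

Lemma avgE b (G : C -> C -> C -> C) z :
  let x := co z 0 in let y := co z 1 in let w := co z ord_max in
  avg b (fun z : D => G (co z 0) (co z 1) (co z ord_max)) z = 6%:R^-1 *
    (G x y w + G w x y + G y w x +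
     (if b then -1 else 1) * (G y x w + G w y x + G x w y)).
Proof.
move=> x y w; pose g : pfun R := fun z => G (co z 0) (co z 1) (co z ord_max).
rewrite -[LHS]/(6%:R^-1 * (\sum_s chi1 R b s *: act s g : pfun R) z).
congr (_ * _); rewrite fct_sumE sum_S3.
have e (s : 'S_3) : (chi1 R b s *: act s g : pfun R) z
  = chi1 R b s * G (co z (s 0)) (co z (s 1)) (co z (s ord_max)).
  by rewrite -[LHS]/(chi1 R b s * g (pact s^-1%g z)) /g !co_pact invgK.
rewrite !{}e !permM !permE /= /chi1 !odd_permM !odd_tperm odd_perm1 /=.
rewrite -/x -/y -/w; case: b; ring.
Qed.

(** One sixth of an alternant; [alt 2 1 0] is (x - y) (x - w) (y - w) / 6, the Vandermonde
    determinant up to a constant. *)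
Definition alt (a b c : nat) : pfun R := avg true (mon3 a b c).

Lemma altE (a b c : nat) z : let x := co z 0 in let y := co z 1 in let w := co z ord_max in
  alt a b c z = 6%:R^-1 * (x ^+ a * y ^+ b * w ^+ c + w ^+ a * x ^+ b * y ^+ c +
    y ^+ a * w ^+ b * x ^+ c - (y ^+ a * x ^+ b * w ^+ c + w ^+ a * y ^+ b * x ^+ c +
    x ^+ a * w ^+ b * y ^+ c)).
Proof.
by rewrite /= /alt (avgE true (fun x y u => x ^+ a * y ^+ b * u ^+ c)) mulN1r.
Qed.

Definition multiple_alt210 f := exists2 c, symmetric_fun c & forall z, f z = c z * alt 2 1 0 z.

Lemma multiple_rec (F : nat -> pfun R) :
  (forall n z, F n.+3 z = esym1 z * F n.+2 z + (-1 * esym2 z) * F n.+1 z + esym3 z * F n z) ->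
  multiple_alt210 (F 0%N) -> multiple_alt210 (F 1%N) -> multiple_alt210 (F 2) ->
  forall n, multiple_alt210 (F n).
Proof.
move=> Frec F0 F1 F2 n.
suff [] : [/\ multiple_alt210 (F n), multiple_alt210 (F n.+1) & multiple_alt210 (F n.+2)] by [].
elim: n => // n [[c0 s0 e0] [c1 s1 e1] [c2 s2 e2]]; split; [by exists c1|by exists c2|].
exists (fun z => esym1 z * c2 z + (-1 * esym2 z) * c1 z + esym3 z * c0 z).
  have sym2 := symmetricM (symmetric_cst (-1)) symmetric_esym2.
  exact: symmetricD (symmetricD (symmetricM symmetric_esym1 s2) (symmetricM sym2 s1))
    (symmetricM symmetric_esym3 s0).
by move=> z; rewrite Frec e0 e1 e2; ring.
Qed.

(* The exponents are lowered by x^(n+3) = e1 x^(n+2) - e2 x^(n+1) + e3 x^n. *)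
Lemma alt_multiple (a b c : nat) : multiple_alt210 (alt a b c).
Proof.
have cst (k : C) f : (forall z, f z = k * alt 2 1 0 z) -> multiple_alt210 f.
  by exists (fun=> k) => //; exact: symmetric_cst.
(* With exponents below 3, the alternant vanishes if two of them agree and is otherwise [alt 2 1 0]
   up to sign. *)
have base (i j k : nat) : (i < 3)%N -> (j < 3)%N -> (k < 3)%N -> multiple_alt210 (alt i j k).
  case: i => [|[|[|//]]] _; case: j => [|[|[|//]]] _; case: k => [|[|[|//]]] _;
  first [ by apply: (cst 0) => z; rewrite !altE; ring
        | by apply: (cst 1) => z; rewrite !altE; ring
        | by apply: (cst (-1)) => z; rewrite !altE; ring ].
have step (i j : nat) : (i < 3)%N -> (j < 3)%N -> multiple_alt210 (alt i j c).
  move=> i3 j3; apply: (multiple_rec (F := alt i j)) => [n z|||]; try exact: base.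
  by rewrite !altE /esym1 /esym2 /esym3 /psum !(exprS _ n.+2) !(exprS _ n.+1) !(exprS _ n); field.
have step2 (i : nat) : (i < 3)%N -> multiple_alt210 (alt i b c).
  move=> i3; apply: (multiple_rec (F := fun n => alt i n c)) => [n z|||]; try exact: step.
  by rewrite !altE /esym1 /esym2 /esym3 /psum !(exprS _ n.+2) !(exprS _ n.+1) !(exprS _ n); field.
apply: (multiple_rec (F := fun n => alt n b c)) => [n z|||]; try exact: step2.
by rewrite !altE /esym1 /esym2 /esym3 /psum !(exprS _ n.+2) !(exprS _ n.+1) !(exprS _ n); field.
Qed.

End SymmetricFunctions.

(** * Inequivalence *)

Section Inequivalence.
Variables (R : realType) (lambda : R) (A : set (pfun R)) (ip : pfun R -> pfun R -> Cx R).
Hypothesis lambda0 : 0 < lambda.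
Hypothesis bergA : weighted_bergman_space lambda A ip.
Local Notation C := (Cx R).
Local Notation D := (polydisc R).
Local Notation K := (bergman_kernel lambda).
Local Notation sqnorm := (nsq ip).
Local Notation hilA := (berg_hilbert bergA).
Local Notation subA := (berg_sub bergA).
Local Notation ipA := (berg_ip bergA).
Local Notation rkA := (berg_rk bergA).
Local Notation sympoly q := (q \is @mpoly.symmetric 3 C).
Local Notation proj p := (isotypic_proj p).
Local Notation mon3 := (@mon3 R).
Local Notation alt := (@alt R).
Local Notation alt_multiple := (alt_multiple R).
Local Notation V p := (isotypic_proj p @` A).
Implicit Types (z w : D) (j : 'I_3) (f g h : pfun R) (s : 'S_3)
  (p : partition3) (q : mpoly.mpoly 3 C).

Lemma V_A p f : V p f -> A f.
Proof. by move=> /(proj_imageP bergA)[]. Qed.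
Lemma V_proj p f : V p f -> proj p f = f.
Proof. by move=> /(proj_imageP bergA)[]. Qed.
Lemma V_intro p f : A f -> proj p f = f -> V p f.
Proof. by move=> Af e; apply/(proj_imageP bergA). Qed.
Lemma V_sub p : subspace (V p).
Proof. by case: (hilbert_module_proj lambda0 bergA p) => [[]]. Qed.
Lemma V_pmul p q f : sympoly q -> V p f -> V p (pmul q f).
Proof.
move=> sq Vf; apply: V_intro; first by apply: (pmulA lambda0 bergA); exact: V_A Vf.
by rewrite proj_pmul // (V_proj Vf).
Qed.
Lemma equivalent_sym p p' : equivalent ip (V p) (V p') -> equivalent ip (V p') (V p).
Proof.
move=> [U [UV Ulin Uip Upm]].
have UW f : V p f -> V p' (U f) by move=> Vf; rewrite -UV; exists f.
have Uinj f g : V p f -> V p g -> U f = U g -> f = g.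
  move=> Vf Vg e; apply/eqP; rewrite -subr_eq0; apply/eqP.
  have Vd := subBV (V_sub p) Vf Vg.
  apply: (nsq_le0 ipA (V_A Vd)); rewrite /nsq -Uip //.
  have -> : U (f - g) = 0 by rewrite addrC -scaleN1r Ulin // e scaleN1r addNr.
  by rewrite (ip0l subA ipA) //; exact: (sub0V subA).
have [T TP] : {T : pfun R -> pfun R & forall g, V p' g -> V p (T g) /\ U (T g) = g}.
  apply: (@choice _ _ (fun g f => V p' g -> V p f /\ U f = g)) => g.
  have [Vg|nVg] := pselect (V p' g); last by exists 0 => /nVg.
  by move: (Vg); rewrite -UV => -[f Vf fg]; exists f.
have VT g : V p' g -> V p (T g) by case/TP.
have UT g : V p' g -> U (T g) = g by case/TP.
exists T; split.
- apply/seteqP; split=> [_ [g Vg <-]|f Vf]; first exact: VT.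
  by exists (U f); [exact: UW | apply: Uinj => //; [exact/VT/UW | rewrite UT //; exact: UW]].
- move=> a f g Vf Vg; have V1 := subPV (V_sub p') a Vf Vg.
  apply: Uinj; [exact: VT | by apply: (subPV (V_sub p)); exact: VT |].
  by rewrite UT // Ulin ?UT //; exact: VT.
- by move=> f g Vf Vg; rewrite -Uip ?UT //; exact: VT.
- move=> q sq f Vf; have V1 := V_pmul sq Vf.
  apply: Uinj; [exact: VT | by apply: V_pmul => //; exact: VT |].
  by rewrite UT // Upm ?UT //; exact: VT.
Qed.

(** Density of the multiples of F is expressed by the triviality of their orthogonal complement in
    the submodule. *)
Definition cyclic p F := V p F /\ forall h, V p h ->
  (forall q, sympoly q -> ip (pmul q F) h = 0) -> h = 0.

Lemma cyclic_transport p p' F : equivalent ip (V p) (V p') -> cyclic p F ->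
  exists G, cyclic p' G.
Proof.
move=> [U [UV Ulin Uip Upm]] [VF cF]; exists (U F).
split=> [|h]; first by rewrite -UV; exists F.
rewrite -UV => -[g Vg <-] H; have g0 : g = 0.
  by apply: cF => // q sq; rewrite -Uip ?Upm ?H //; exact: V_pmul.
apply: (nsq_le0 ipA); first by apply: (@V_A p'); rewrite -UV; exists g.
by rewrite /nsq Uip // g0 (ip0l subA ipA) //; exact: (sub0V subA).
Qed.

(** If h is orthogonal to the multiples of F, then <h, z^alpha> = <h, P z^alpha> = 0 for all alpha,
    and the monomials are total. *)
Lemma cyclic_mon p F : V p F ->
  (forall al, exists2 c : D -> C, symmetric_fun c & proj p (mon al) = (fun z => c z * F z)) ->
  cyclic p F.
Proof.
move=> VF H; split=> // h Vh hq; have Ah := V_A Vh.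
apply: (mon_total lambda0 bergA) => // al; have Am := monA lambda0 bergA al.
have [c [q sq cE] e] := H al.
rewrite -(V_proj Vh) (ip_proj bergA) // e.
have -> : ((fun z => c z * F z) : pfun R) = pmul q F by apply/funext => z; rewrite cE.
have Aq : A (pmul q F) by apply: (pmulA lambda0 bergA); exact: V_A VF.
by rewrite (ip_conj ipA Aq Ah) hq // conjC0.
Qed.

Lemma mon3A (a b c : nat) : A (mon3 a b c).
Proof. by rewrite -mon_exp3; exact: (monA lambda0 bergA). Qed.

Definition one : pfun R := mon3 0 0 0.

Lemma oneE z : one z = 1.
Proof. by rewrite /one /mon3 !expr0 !mulr1. Qed.

Lemma cyclic_one : cyclic Part3 one.
Proof.
have e1 : proj Part3 one = one.
  rewrite isotypic_projE; apply/funext => z.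
  rewrite (avgE false (fun x y u => x ^+ 0 * y ^+ 0 * u ^+ 0)) oneE !expr0.
  by field.
apply: cyclic_mon; first by apply: V_intro => //; exact: mon3A.
move=> al; pose X := mpoly.mpolyX C (mpoly.Multinom [tuple al i | i < 3]).
exists (ev (6%:R^-1 *: \sum_s mpoly.msym s X)).
  eexists; last by [].
  apply: rpredZ; apply/mpoly.issymP => t; rewrite raddf_sum [RHS](reindex_inj (mulIg t)).
  by apply: eq_bigr => s _; rewrite /= mpoly.msymMm.
have -> : (mon al : pfun R) = ev X.
  by apply/funext => z; rewrite /ev mpoly.mevalX; apply: eq_bigr => j _; rewrite mpoly.mnmE.
rewrite isotypic_projE; apply/funext => z; rewrite oneE mulr1 /ev mpoly.mevalZ.
rewrite -[LHS]/(6%:R^-1 * (\sum_s chi1 R false s *: act s (ev X) : pfun R) z).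
congr (_ * _); rewrite fct_sumE raddf_sum; apply: eq_bigr => s _.
by rewrite ev_act -[LHS]/(chi1 R false s * _) /chi1 mul1r.
Qed.

Lemma altA (a b c : nat) : A (alt a b c).
Proof. exact: (avgA bergA true (mon3A a b c)). Qed.

Lemma V_alt (a b c : nat) : V Part111 (alt a b c).
Proof. by apply: V_intro; [exact: altA | rewrite isotypic_projE avg_idem]. Qed.

Lemma cyclic_alt : cyclic Part111 (alt 2 1 0).
Proof.
apply: cyclic_mon; first exact: V_alt.
move=> al; have [c sc e] := alt_multiple (al 0) (al 1) (al ord_max).
by exists c => //; rewrite isotypic_projE mon_mon3; apply/funext => z; exact: e.
Qed.

Definition point (v : 'I_3 -> R) (v1 : forall j, v j ^+ 2 < 1) : D.
Proof.
exists (\row_j (rC (v j) : C)).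
by apply/forallP => j; rewrite mxE norm_lt1 sqn_rC.
Defined.

Lemma co_point v v1 j : co (@point v v1) j = rC (v j).
Proof. by rewrite /co /= mxE. Qed.

(* The orbit points used are (0, 1/4, 1/2) and (1/4, 0, 1/2). *)
Lemma not_cyclic21 F : ~ cyclic Part21 F.
Proof.
move=> [VF cF]; have AF := V_A VF.
(* The projection of k to type (2,1) is still orthogonal to the multiples of F, so cyclicity makes
   it zero. *)
have perp k : A k -> (forall q, sympoly q -> ip (pmul q F) k = 0) ->
    forall f, V Part21 f -> ip f k = 0.
  move=> Ak H f Vf; have Af := V_A Vf.
  have k0 : proj Part21 k = 0.
    apply: cF => [|q sq]; first by exists k.
    have Vq := V_pmul sq VF; rewrite -(ip_proj bergA) //; last exact: V_A Vq.
    by rewrite (V_proj Vq) H.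
  by rewrite -(V_proj Vf) (ip_proj bergA) // k0 (ip0r subA ipA).
pose v (j : 'I_3) : R := nth 0 [:: 0; 4^-1; 2^-1] j.
have v1 j : v j ^+ 2 < 1.
  by rewrite /v; case: j => [[|[|[|//]]]] /= _; lra.
pose z := point v1; pose z' := pact (tperm 0%R 1%R) z.
have evz q : sympoly q -> ev q z' = ev q z by move=> sq; rewrite /z' ev_sym.
have KA w : A (K ^~ w) by exact: (kerA rkA w).
(* Pairing with k sends f to F z' f z - F z f z'. This vanishes on the multiples q F, because q
   takes the same value at z and z'. *)
have prop f : V Part21 f -> f z * F z' = f z' * F z.
  move=> Vf; pose k : pfun R := (F z')^* *: (K ^~ z : pfun R) - (F z)^* *: (K ^~ z' : pfun R).
  have A1 : A ((F z')^* *: (K ^~ z : pfun R)) by exact: (subZV subA).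
  have A2 : A ((F z)^* *: (K ^~ z' : pfun R)) by exact: (subZV subA).
  have Ak : A k by exact: (subBV subA).
  have ipk g : A g -> ip g k = F z' * g z - F z * g z'.
    move=> Ag; rewrite /k (ipBr subA ipA) // !(ipZr subA ipA) // !conjCK.
    by rewrite !(reproducing rkA).
  have k0 q : sympoly q -> ip (pmul q F) k = 0.
    move=> sq; rewrite ipk; last exact: (pmulA lambda0 bergA).
    by rewrite !pmulE evz //; ring.
  have Af := V_A Vf; have := perp k Ak k0 f Vf; rewrite ipk // => /eqP.
  by rewrite subr_eq0 => /eqP e; rewrite mulrC e mulrC.
pose d1 : pfun R := mon3 1 0 0 - mon3 0 1 0.
pose d2 : pfun R := mon3 0 1 0 - mon3 0 0 1.
have V21 f : A f -> avg false f = 0 -> avg true f = 0 -> V Part21 f.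
  by move=> Af h1 h2; apply: V_intro => //; rewrite isotypic_projE h1 h2 !subr0.
have avgm b (n1 n2 n3 : nat) : avg b (mon3 n1 n2 n3) =
    (fun z => 6%:R^-1 * (co z 0 ^+ n1 * co z 1 ^+ n2 * co z ord_max ^+ n3
      + co z ord_max ^+ n1 * co z 0 ^+ n2 * co z 1 ^+ n3
      + co z 1 ^+ n1 * co z ord_max ^+ n2 * co z 0 ^+ n3 +
      (if b then -1 else 1) * (co z 1 ^+ n1 * co z 0 ^+ n2 * co z ord_max ^+ n3
      + co z ord_max ^+ n1 * co z 1 ^+ n2 * co z 0 ^+ n3
      + co z 0 ^+ n1 * co z ord_max ^+ n2 * co z 1 ^+ n3))).
  by apply/funext => w; rewrite (avgE b (fun x y u => x ^+ n1 * y ^+ n2 * u ^+ n3)).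
have V1 : V Part21 d1.
  apply: V21; first by apply: (subBV subA); exact: mon3A.
    rewrite /d1 avgB !avgm; apply/funext => w; rewrite -[LHS]/(_ - _) -[RHS]/(0 : C).
    by ring.
  rewrite /d1 avgB !avgm; apply/funext => w; rewrite -[LHS]/(_ - _) -[RHS]/(0 : C).
  by ring.
have V2 : V Part21 d2.
  apply: V21; first by apply: (subBV subA); exact: mon3A.
    rewrite /d2 avgB !avgm; apply/funext => w; rewrite -[LHS]/(_ - _) -[RHS]/(0 : C).
    by ring.
  rewrite /d2 avgB !avgm; apply/funext => w; rewrite -[LHS]/(_ - _) -[RHS]/(0 : C).
  by ring.
have d1E w : d1 w = co w 0 - co w 1.
  by rewrite -[LHS]/(mon3 1 0 0 w - mon3 0 1 0 w) /mon3; ring.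
have d2E w : d2 w = co w 1 - co w ord_max.
  by rewrite -[LHS]/(mon3 0 1 0 w - mon3 0 0 1 w) /mon3; ring.
have c0 : co z 0 = 0 by rewrite co_point.
have c1 : co z 1 = 4%:R^-1 by rewrite co_point rCV rC_nat.
have c2 : co z ord_max = 2%:R^-1 by rewrite co_point rCV rC_nat.
have c0' : co z' 0 = 4%:R^-1 by rewrite co_pact tpermV tpermL c1.
have c1' : co z' 1 = 0 by rewrite co_pact tpermV tpermR c0.
have c2' : co z' ord_max = 2%:R^-1 by rewrite co_pact tpermV tpermD // c2.
have h1 := prop _ V1; have h2 := prop _ V2.
rewrite !d1E c0 c1 c0' c1' in h1; rewrite !d2E c1 c2 c1' c2' in h2.
(* [h1] says F z' = - F z and [h2] says F z' = 2 F z. *)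
have Fz : F z = 0.
  have -> : F z = 4%:R / 3%:R * (((0 - 4%:R^-1) * F z' - (4%:R^-1 - 0) * F z) -
      ((4%:R^-1 - 2%:R^-1) * F z' - (0 - 2%:R^-1) * F z)) * (-1) by field.
  by rewrite h1 h2 !subrr !mulr0 mul0r.
(* All multiples of F vanish at z, hence so does the whole submodule; but d1 z = - 1/4. *)
have z0 q : sympoly q -> ip (pmul q F) (K ^~ z) = 0.
  move=> sq; rewrite (reproducing rkA); last exact: (pmulA lambda0 bergA).
  by rewrite pmulE Fz mulr0.
have A1 := V_A V1; have := perp _ (KA z) z0 d1 V1; rewrite (reproducing rkA) // d1E c0 c1.
by move/eqP; rewrite sub0r oppr_eq0 invr_eq0 pnatr_eq0.
Qed.

End Inequivalence.

(** * Norms of alternants and the comparison of (3) with (1,1,1) *)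

Section SymmetricVersusAntisymmetric.
Variables (R : realType) (lambda : R) (A : set (pfun R)) (ip : pfun R -> pfun R -> Cx R).
Hypothesis lambda0 : 0 < lambda.
Hypothesis bergA : weighted_bergman_space lambda A ip.
Local Notation C := (Cx R).
Local Notation D := (polydisc R).
Local Notation K := (bergman_kernel lambda).
Local Notation sqnorm := (nsq ip).
Local Notation hilA := (berg_hilbert bergA).
Local Notation subA := (berg_sub bergA).
Local Notation ipA := (berg_ip bergA).
Local Notation rkA := (berg_rk bergA).
Local Notation sympoly q := (q \is @mpoly.symmetric 3 C).
Local Notation proj p := (isotypic_proj p).
Local Notation mon3 := (@mon3 R).
Local Notation alt := (@alt R).
Local Notation one := (@one R).
Local Notation V p := (isotypic_proj p @` A).
Implicit Types (z w : D) (j : 'I_3) (f g h : pfun R) (s : 'S_3)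
  (p : partition3) (q : mpoly.mpoly 3 C).

Lemma origin1 (j : 'I_3) : (fun=> 0 : R) j ^+ 2 < 1.
Proof. by rewrite expr0n ltr01. Qed.

Definition origin : D := point origin1.

Lemma co_origin j : co origin j = 0.
Proof. by rewrite co_point. Qed.

(** The constant 1 is the kernel function at the origin. *)
Lemma ip_one f : A f -> ip f one = f origin.
Proof.
move=> Af; rewrite -(reproducing rkA) //; congr (ip f _); apply/funext => z.
rewrite oneE kernelE big1 // => j _; rewrite /factor co_origin conjC0 mulr0 subr0.
rewrite /cpow /= mul0r atan0 mulr0 cos0 sin0 mulr0 mulr1 expr1n expr0n addr0.
by rewrite sqrtr1 powR1.
Qed.

Lemma alt_weight : weight (fun=> 1%N) 3 (alt 2 1 0).
Proof. by move=> xi xi1 z; rewrite !altE !co_rot expr1; ring. Qed.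

(** The alternant is homogeneous of degree 3, hence orthogonal to its product with any nonconstant
    monomial; only the constant coefficient of q contributes. *)
Lemma ip_alt_pmul q : ip (alt 2 1 0) (pmul q (alt 2 1 0)) =
  (ev q origin)^* * rC (sqnorm (alt 2 1 0)).
Proof.
set ga := alt 2 1 0; have Aga : A ga by exact: (altA lambda0 bergA).
pose g (m : mpoly.multinom 3) : pfun R := fun z => mon m z * ga z.
have Ag m : A (g m).
  have -> : g m = pmul (mpoly.mpolyX C m) ga.
    by apply/funext => z; rewrite pmulE /ev mpoly.mevalX.
  exact: (pmulA lambda0 bergA).
have -> : pmul q ga = \sum_(m <- mpoly.msupp q) mpoly.mcoeff m q *: g m.
  apply/funext => z; rewrite pmulE /ev mpoly.mevalE big_distrl fct_sumE.
  by apply: eq_bigr => m _; rewrite -[RHS]/(_ * (mon m z * ga z)) mulrA.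
rewrite (ip_sumr subA ipA) //; last by move=> m _; exact: (subZV subA).
rewrite /ev mpoly.mevalE rmorph_sum big_distrl; apply: eq_bigr => m _ /=.
rewrite (ipZr subA ipA) // rmorphM -mulrA; congr (_ * _).
have [m0|] := eqVneq (\sum_j m j)%N 0%N.
  have mj j : m j = 0%N by move/eqP: m0; rewrite sum_nat_eq0 => /forallP /(_ j) /eqP.
  have -> : g m = ga.
    by apply/funext => z; rewrite /g /mon big1 ?mul1r // => j _; rewrite mj expr0.
  by rewrite (ipff ipA Aga) big1 ?rmorph1 ?mul1r // => j _; rewrite mj expr0.
move=> m0; rewrite (weight_orth (e := fun=> 1%N) bergA (m := 3) (n := (\sum_j m j + 3)%N)) //.
- have [j mj] : exists j, m j != 0%N.
    apply/existsP; apply: contraNT m0; rewrite negb_exists => /forallP H.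
    by rewrite big1 // => j _; have := H j; rewrite negbK => /eqP.
  by rewrite (bigD1 j) //= co_origin expr0n (negPf mj) mul0r rmorph0 mul0r.
- by apply: contra_neq m0 => e; apply: (@addIn 3); rewrite -e.
- exact: alt_weight.
- move=> xi xi1 z; rewrite /g /ga (alt_weight xi1 z).
  have := @mon_weight R (fun=> 1%N) m xi xi1 z => ->.
  by under eq_bigr do rewrite mul1n; rewrite exprD; ring.
Qed.

Lemma mcoef_exp3 (a b c : nat) :
  mcoef lambda (exp3 a b c) = bcoef lambda a * bcoef lambda b * bcoef lambda c.
Proof. by rewrite /mcoef !big_ord_recl big_ord0 mulr1 mulrA. Qed.

Lemma nsq_mon3 (a b c : nat) :
  sqnorm (mon3 a b c) = (bcoef lambda a * bcoef lambda b * bcoef lambda c)^-1.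
Proof. by rewrite -mon_exp3 (nsq_mon lambda0 bergA) mcoef_exp3. Qed.

Lemma act_mon s al : act s (mon al : pfun R) = mon (fun j => al (s^-1%g j)).
Proof.
apply/funext => z; rewrite /act /mon [RHS](reindex_inj (@perm_inj _ s)).
by apply: eq_bigr => j _; rewrite co_pact invgK permK.
Qed.

(** The average is a self-adjoint idempotent, so the left-hand side pairs z^alpha with its own
    average. The exponents being distinct, every permutation other than 1 gives an orthogonal
    monomial, which leaves the factor 1/6. *)
Lemma nsq_alt (a b c : nat) : (b < a)%N -> (c < b)%N ->
  sqnorm (alt a b c) = (6%:R * (bcoef lambda a * bcoef lambda b * bcoef lambda c))^-1.
Proof.
move=> ab bc; have AM := mon3A lambda0 bergA a b c.
have inj : injective (exp3 a b c).
  by move=> [[|[|[|//]]] ?] [[|[|[|//]]] ?]; rewrite /exp3 /= => e; apply/val_inj => //=; lia.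
rewrite /nsq /alt (ip_avg bergA) ?avg_idem //; last exact: (avgA bergA).
have Aact s : A (act s (mon3 a b c)) by exact: (actA bergA).
have Achi s : A (chi1 R true s *: act s (mon3 a b c)) by exact: (subZV subA).
rewrite /avg (ipZr subA ipA) //; last exact: (sub_sumV subA).
rewrite (ip_sumr subA ipA) // (bigD1 1%g) //= big1 ?addr0 => [|s s1].
  rewrite odd_perm1 expr0 scale1r act1 (ipff ipA AM).
  by rewrite fmorphV rmorph_nat -rC_nat -rCV -rCM re_rC nsq_mon3 [RHS]invfM.
rewrite (ipZr subA ipA) // -mon_exp3 act_mon.
have [j sj] : exists j, s^-1%g j != j.
  apply/existsP; apply: contraNT s1; rewrite negb_exists => /forallP H.
  apply/eqP/permP => j; rewrite perm1; have := H (s j).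
  by rewrite permK negbK => /eqP.
by rewrite (mon_orth lambda0 bergA (j := j)) ?mulr0 //; apply: contra_neq sj => /inj.
Qed.

Lemma nsq_esym1 : sqnorm (fun z => esym1 z) = 3%:R / lambda.
Proof.
have -> : ((fun z => esym1 z) : pfun R) = mon3 1 0 0 + mon3 0 1 0 + mon3 0 0 1.
  apply/funext => z; rewrite /esym1 /psum.
  by rewrite -[RHS]/(mon3 1 0 0 z + mon3 0 1 0 z + mon3 0 0 1 z) /mon3; ring.
have M (a b c : nat) : A (mon3 a b c) by exact: (mon3A lambda0 bergA).
have o (a b c a' b' c' : nat) j : exp3 a b c j != exp3 a' b' c' j ->
    ip (mon3 a b c) (mon3 a' b' c') = 0.
  by move=> ne; rewrite -!mon_exp3; exact: (mon_orth lambda0 bergA ne).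
have o12 := @o 1%N 0%N 0%N 0%N 1%N 0%N 0 isT; have o13 := @o 1%N 0%N 0%N 0%N 0%N 1%N 0 isT.
have o23 := @o 0%N 1%N 0%N 0%N 0%N 1%N 1 isT; have A12 := subDV subA (M 1 0 0)%N (M 0 1 0)%N.
rewrite (nsqD subA ipA) // (nsqD subA ipA) // (ipDl ipA) // o12 o13 o23.
rewrite !nsq_mon3 bcoefS !bcoef0 !cE.
by field; rewrite gt_eqF.
Qed.

Lemma not_equivalent3_111 : ~ equivalent ip (V Part3) (V Part111).
Proof.
move=> [U [UV Ulin Uip Upm]]; set ga := alt 2 1 0.
have [V1 _] := cyclic_one lambda0 bergA.
have [Vg cg] := cyclic_alt lambda0 bergA; have Ag := V_A bergA Vg.
have [G VG UG] : exists2 G, V Part3 G & U G = ga by move: (Vg); rewrite -UV => -[G ? ?]; exists G.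
pose F := U one; have VF : V Part111 F by rewrite -UV; exists one.
have AF := V_A bergA VF; have AG := V_A bergA VG; have A1 := V_A bergA V1.
have n0 : 0 < sqnorm ga.
  rewrite nsq_alt // invr_gt0 !mulr_gt0 ?bcoef_gt0 //.
(* The only scalar that makes F - c ga orthogonal to ga. *)
pose c := (G origin)^* / rC (sqnorm ga).
have Fc : F = c *: ga.
  apply/eqP; rewrite -subr_eq0; apply/eqP.
  have Vcg := subZV (V_sub lambda0 bergA Part111) c Vg.
  apply: cg => [|q sq]; first exact: (subBV (V_sub lambda0 bergA Part111)).
  have Aq : A (pmul q ga) by exact: (pmulA lambda0 bergA).
  have AqG : A (pmul q G) by exact: (pmulA lambda0 bergA).
  have Acg := subZV subA c Ag.
  rewrite (ip_conj ipA (subBV subA AF Acg) Aq) (ipBl subA ipA) // (ipZl subA ipA) //.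
  rewrite ip_alt_pmul -/ga.
  (* Since q ga = U (q G), unitarity turns this into <1, q G>, which is evaluation at the origin up
     to conjugation. *)
  have -> : ip F (pmul q ga) = (ev q origin)^* * (G origin)^*.
    rewrite -UG -Upm // /F Uip //; last exact: (V_pmul lambda0 bergA).
    by rewrite (ip_conj ipA AqG A1) ip_one // pmulE rmorphM.
  have rn : rC (sqnorm ga) != 0 by apply: contra_neq (lt0r_neq0 n0) => /rC_inj.
  by rewrite /c mulrCA mulfVK // subrr conjC0.
have [q sq e1] := symmetric_esym1 R.
have nF : sqnorm F = 1 by rewrite /nsq Uip // -/(nsq ip one) nsq_mon3 !bcoef0 !mulr1 invr1.
have nqF : sqnorm (pmul q F) = 3%:R / lambda.
  have Vq := V_pmul lambda0 bergA sq V1.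
  rewrite /nsq -Upm // Uip // -nsq_esym1; congr (nsq ip _).
  by apply/funext => z; rewrite pmulE oneE mulr1 e1.
(* Raising one exponent of [alt 2 1 0] by 1 in all ways gives [alt 3 1 0], [alt 2 2 0] and
   [alt 2 1 1]; the last two vanish. *)
have qF : pmul q F = c *: alt 3 1 0.
  apply/funext => z; rewrite pmulE Fc -e1 -[LHS]/(esym1 z * (c * alt 2 1 0 z)).
  by rewrite -[RHS]/(c * alt 3 1 0 z) !altE /esym1 /psum; field.
have A3 : A (alt 3 1 0) by exact: (altA lambda0 bergA).
move: nF nqF; rewrite qF Fc (nsqZ subA ipA _ Ag) (nsqZ subA ipA _ A3) /ga.
rewrite !nsq_alt // !bcoefS !bcoef0.
move: (sqn c) => x; have l0 := lambda0.
have d1 : lambda + 1 != 0 by rewrite gt_eqF // addr_gt0.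
have d2 : lambda + 2%:R != 0 by rewrite gt_eqF // addr_gt0.
have d0 : lambda != 0 by rewrite gt_eqF.
move=> h1 h2.
(* The quotient of [h2] by [h1] is a_2 / a_3 = 3 / (lambda + 2) = 3 / lambda. *)
have h3 : 3%:R / lambda * (lambda + 2%:R) = 3%:R.
  by rewrite -h2 -[RHS]mulr1 -[X in _ = _ * X]h1; field; rewrite d2 d1 d0.
have h4 : 3%:R / lambda * (lambda + 2%:R) = 3%:R + 6%:R / lambda by field.
have : 0 < 6%:R / lambda by rewrite divr_gt0.
by rewrite h3 in h4; lra.
Qed.

End SymmetricVersusAntisymmetric.

Theorem corollary4p18 (R : realType) (lambda : R) (A : set (pfun R))
    (ip : pfun R -> pfun R -> Cx R) :
  0 < lambda ->
  weighted_bergman_space lambda A ip ->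
  [/\ hilbert_module A ip,
      forall p : partition3, hilbert_module (isotypic_proj p @` A) ip,
      orthogonal_sum ip A (fun p => isotypic_proj p @` A)
    & forall p q : partition3, p <> q ->
        ~ equivalent ip (isotypic_proj p @` A) (isotypic_proj q @` A)].
Proof.
move=> l0 bA; split.
- exact: hilbert_module_A l0 bA.
- exact: hilbert_module_proj l0 bA.
- exact: orthogonal_sum_proj bA.
have n31 := not_equivalent3_111 l0 bA.
(* An equivalence with (2,1) would carry a cyclic vector there. *)
have n21 p F : equivalent ip (isotypic_proj p @` A) (isotypic_proj Part21 @` A) ->
    ~ cyclic A ip p F.
  move=> e cF; have [G] := cyclic_transport l0 bA e cF.
  exact: (not_cyclic21 l0 bA).
have c3 := cyclic_one l0 bA; have c111 := cyclic_alt l0 bA.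
have sym p q := @equivalent_sym _ _ _ _ l0 bA p q.
by case=> [] [] // _ e; first [exact: n31 e | exact: n31 (sym _ _ e)
  | exact: n21 e c3 | exact: n21 e c111 | exact: n21 (sym _ _ e) c3 | exact: n21 (sym _ _ e) c111].
Qed.
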